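(* Let $G$ be a tree or a connected unicyclic graph with the unique cycle of length $d\in\{3,4\}$. Then $$\operatorname{reg}\mathcal{R}(I_c(G))\le |V(G)|.$$
   Context: Let $K$ be a field, let $G$ be a finite simple graph with vertex set $V(G)=[n]=\{1,\dots,n\}$ and edge set $E(G)=\{e_1,\dots,e_m\}$, and let $S=K[x_1,\dots,x_n]$. For each $i$, write $e_i=\{p,q\}$ and put $u_i=(x_1\cdots x_n)/(x_px_q)$. The complementary edge ideal of $G$ is $I_c(G)=(u_1,\dots,u_m)\subset S$, and its Rees algebra is $\mathcal{R}(I_c(G))=\bigoplus_{k\ge 0}I_c(G)^kt^k\subset S[t]$. Let $T=S[y_1,\dots,y_m]$ be the polynomial ring with all variables $x_i,y_j$ of degree $1$, and let $J$ be the kernel of the $S$-algebra homomorphism $T\to\mathcal{R}(I_c(G))$, $y_i\mapsto u_it$. Then $\operatorname{reg}\mathcal{R}(I_c(G))$ denotes the Castelnuovo–Mumford regularity of the graded $T$-module $T/J\cong\mathcal{R}(I_c(G))$. A graph is unicyclic if it contains exactly one cycle. *)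

(* Defs.v *)
From HB Require Import structures.
From mathcomp Require Import all_boot all_order all_algebra.
From mathcomp Require Import mpoly.

Set Implicit Arguments.
Unset Strict Implicit.
Unset Printing Implicit Defensive.

Import Order.TTheory GRing.Theory Num.Theory.

Local Open Scope ring_scope.

Section Graphs.
Variable V : finType.
Implicit Types (e : rel V) (C : {set {set V}}).

(* Qualified because mpoly shadows [symmetric] with symmetric polynomials. *)
Definition simple_graph e : Prop := ssrbool.symmetric e /\ irreflexive e.

Definition edge_set e : {set {set V}} :=
  [set [set z.1; z.2] | z : V * V & e z.1 z.2].

Definition graph_connected e : Prop :=
  (0 < #|V|)%N /\ forall x y, connect e x y.

(* Cycles are subgraphs, hence identified with their edge sets: the 2d closed
   walks running along the same cycle of length d count as one cycle. *)
Definition graph_cycle e C : Prop :=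
  exists c : seq V, [/\ (2 < size c)%N, ucycle e c
                      & C = [set [set x; next c x] | x in c]].

Definition is_tree e : Prop :=
  graph_connected e /\ forall C, ~ graph_cycle e C.

Definition connected_unicyclic e (d : nat) : Prop :=
  graph_connected e /\
  exists C, [/\ graph_cycle e C, forall C', graph_cycle e C' -> C' = C
              & #|C| = d].

End Graphs.

Section Regularity.
Variables (K : fieldType) (N : nat).

(* Homogeneity for an integer degree: for d < 0 only 0 is homogeneous. *)
Definition zhomog (d : int) (p : {mpoly K[N]}) : Prop :=
  {in msupp p, forall m, (mdeg m)%:Z = d}.

(* Minimal graded free resolutions of T/J, where T = K[X_0..X_(N-1)] is
   standard graded and J is a homogeneous ideal:
     ... -> F_2 -> F_1 -> F_0 -> T/J -> 0,
   F_i being the direct sum of the T(- rdeg i k) for k < rk i.  Elements of F_i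
   are row vectors and matrices act on the right; aug lists representatives in
   T of the images in T/J of the basis of F_0.  Minimality says that the image
   of F_(i+1) lies in (X_0, ..., X_(N-1)) F_i, i.e. that the entries of the
   matrices have no constant term. *)
Record min_graded_resolution (J : {mpoly K[N]} -> Prop) := MinGradedResolution {
  rk : nat -> nat;
  rdeg : forall i, 'I_(rk i) -> int;
  aug : 'cV[{mpoly K[N]}]_(rk 0);
  dif : forall i, 'M[{mpoly K[N]}]_(rk i.+1, rk i);
  aug_homog : forall k, zhomog (rdeg k) (aug k 0);
  dif_homog : forall i j k, zhomog (rdeg j - rdeg k) (dif i j k);
  aug_surj : forall p, exists v : 'rV_(rk 0), J (p - (v *m aug) 0 0);
  exact_aug : forall v : 'rV_(rk 0),
    J ((v *m aug) 0 0) <-> exists w, v = w *m dif 0;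
  exact_dif : forall i (v : 'rV_(rk i.+1)),
    v *m dif i = 0 <-> exists w, v = w *m dif i.+1;
  dif_minimal : forall i j k, (dif i j k)@_0%MM = 0
}.

(* reg(T/J) = max {j - i | beta_(i,j)(T/J) != 0}, where beta_(i,j) is the number
   of basis elements of degree j of the i-th module of a minimal graded free
   resolution.  Such a resolution is unique up to isomorphism, so at most one r
   satisfies this predicate. *)
Definition is_regularity (J : {mpoly K[N]} -> Prop) (r : int) : Prop :=
  exists F : min_graded_resolution J,
    (forall i (k : 'I_(rk F i)), rdeg k - i%:Z <= r) /\
    (exists i (k : 'I_(rk F i)), rdeg k - i%:Z = r).

End Regularity.

Section ComplementaryEdgeIdeal.
Variables (K : fieldType) (n : nat) (e : rel 'I_n).

Local Notation m := #|edge_set e|.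

Definition edge (j : 'I_m) : {set 'I_n} := enum_val j.

(* (x_1 ... x_n) / (x_p x_q) for the j-th edge {p, q} *)
Definition comp_edge_gen (j : 'I_m) : {mpoly K[n]} :=
  \prod_(i | i \notin edge j) 'X_i.

(* The map T = K[x_1..x_n, y_1..y_m] -> S[t]; the first n variables of T are
   the x_i, the last m ones are the y_j, and t is the variable of {poly _}. *)
Definition rees_map (p : {mpoly K[n + m]}) : {poly {mpoly K[n]}} :=
  mmap (polyC \o @mpolyC n K)
       (fun v => match split v with
                 | inl i => ('X_i)%:P
                 | inr j => (comp_edge_gen j)%:P * 'X
                 end) p.

(* The image of rees_map is the Rees algebra of the ideal generated by the
   comp_edge_gen j, so this is its defining ideal J. *)
Definition rees_ideal (p : {mpoly K[n + m]}) : Prop := rees_map p = 0.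

End ComplementaryEdgeIdeal.

(* Main.v *)
Require Import Defs.
From HB Require Import structures.
From mathcomp Require Import all_boot all_order all_algebra.
From mathcomp Require Import mpoly.
From mathcomp Require Import zify ring.

Set Implicit Arguments.
Unset Strict Implicit.
Unset Printing Implicit Defensive.

Import Order.TTheory GRing.Theory Num.Theory.
Local Open Scope ring_scope.

(** Why the theorem holds.  Put X = x_1 ... x_n.  The Rees algebra is spanned by
    monomials, being generated by the x_v and the X t / (x_p x_q), one for each
    edge {p, q}; so J is the kernel of a ring morphism that maps monomials to
    monomials.  Such a kernel is prime, and it is spanned by the differences of
    two monomials with the same image ([toric_ker_span]).

    The graph is built up one vertex at a time.  For a set W of vertices let
    J_W be the ideal of the subgraph induced on W, taken in the ring T of the
    whole graph: the variables outside the subgraph are free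
    ([subgraph_ideal]).  Let q be a vertex outside W with exactly one neighbour
    p in W, and let r be a neighbour of p in W.  The monomials x_q y_pq and
    x_r y_pr have the same image, and in fact
      J_(W + q) = J_W + (x_q y_pq - x_r y_pr)          ([attach_ideal]):
    modulo the new binomial every monomial can be rewritten until x_q or y_pq
    no longer occurs, and two monomials of this form with the same image for
    W + q have the same image for W.  The binomial is not in the prime ideal
    J_W, hence is regular on T/J_W; the mapping cone of the multiplication by
    it, on a minimal resolution of T/J_W, is a minimal resolution of
    T/J_(W + q), and the regularity grows by exactly 1
    ([regularity_add_regular]).

    It remains to start.  For a tree, W is one vertex and J_W = 0.  For a
    triangle, J_W is the ideal of 2-minors of a 2 x 3 matrix of distinct
    variables, with the Hilbert-Burch resolution 0 -> T^2 -> T^3 -> T and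
    regularity 1 ([regularity_triangle]).  For a 4-cycle, J_W is generated by
    the five 4 x 4 Pfaffians of a skew-symmetric 5 x 5 matrix of variables and
    zeros, with resolution 0 -> T -> T^5 -> T^5 -> T and regularity 2
    ([regularity_four_cycle]).  From then on reg(T/J_W) <= |W| persists, since
    every new vertex has exactly one neighbour in the connected set W reached
    so far: a second one would close a cycle through the new vertex, whereas
    all cycles of the graph lie in the set from which the construction started
    ([new_neighbour_uniq]). *)

(** * Kernels of monomial maps *)
Section MonomialMaps.
Variables (K : fieldType) (N M : nat).
Variable h : 'I_N -> 'X_{1..M} * nat.

Definition mnm_weight (k : 'X_{1..N}) : 'X_{1..M} * nat :=
  ((\sum_i (h i).1 *+ k i)%MM, (\sum_i (h i).2 * k i)%N).

(** The exponent of [t] is kept apart from the other exponents, so that the map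
    onto the Rees algebra is of this form. *)
Definition toric_map : {mpoly K[N]} -> {poly {mpoly K[M]}} :=
  mmap (polyC \o @mpolyC M K) (fun i => ('X_[(h i).1])%:P * 'X^((h i).2)).

HB.instance Definition _ := GRing.RMorphism.on toric_map.

Lemma toric_mapX k :
  toric_map 'X_[k] = ('X_[(mnm_weight k).1])%:P * 'X^((mnm_weight k).2).
Proof.
rewrite /toric_map mmapX /mmap1.
under eq_bigr => i _ do rewrite exprMn -polyC_exp mpolyXn -exprM.
rewrite big_split /= -rmorph_prod /= -expr_sum; congr (_%:P * _).
by elim/big_ind2: _ => [|p a q b -> ->|//]; rewrite ?mpolyX0 ?mpolyXD.
Qed.

Lemma toric_mapE p :
  toric_map p = \sum_(k <- msupp p)
    (p@_k *: 'X_[(mnm_weight k).1])%:P * 'X^((mnm_weight k).2).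
Proof.
rewrite {1}[p]mpolyE raddf_sum /=; apply: eq_bigr => k _.
by rewrite /toric_map mmapZ -/toric_map toric_mapX /= mulrA -polyCM mul_mpolyC.
Qed.

(** Distinct weights give distinct monomials, so the image vanishes as soon as
    the coefficients add up to zero over each class of monomials of equal
    weight. *)
Lemma toric_kerP p :
  toric_map p = 0 <->
  forall w, \sum_(k <- msupp p | mnm_weight k == w) p@_k = 0.
Proof.
have cf a d : (toric_map p)`_d@_a
    = \sum_(k <- msupp p | mnm_weight k == (a, d)) p@_k.
  rewrite toric_mapE coef_sum raddf_sum big_mkcond [RHS]big_mkcond.
  apply: eq_bigr => k _; rewrite coefCM coefXn.
  case: (mnm_weight k) => b c /=; rewrite xpair_eqE (eq_sym d).
  case: (c == d) => /=; last by rewrite andbF mulr0 mcoeff0.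
  rewrite mulr1 mcoeffZ mcoeffX andbT.
  by case: (b == a); rewrite ?mulr1 ?mulr0.
split=> [p0 [a d]|p0]; first by rewrite -cf p0 coef0 mcoeff0.
by apply/polyP=> d; apply/mpolyP=> a; rewrite cf p0 coef0 mcoeff0.
Qed.

Lemma toric_ker_binomial k k' :
  toric_map ('X_[k] - 'X_[k']) = 0 <-> mnm_weight k = mnm_weight k'.
Proof.
rewrite raddfB /= !toric_mapX; split=> [/eqP|->]; last by rewrite subrr.
rewrite subr_eq0 => /eqP E.
move: (mnm_weight k) (mnm_weight k') E => [a d] [b c] /= E.
have := congr1 (fun q : {poly {mpoly K[M]}} => q`_d@_a) E.
rewrite /= !coefCM !coefXn eqxx mulr1 mcoeffX eqxx.
case: eqP => [e2|_]; last by rewrite mulr0 mcoeff0 => /eqP; rewrite oner_eq0.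
rewrite mulr1 mcoeffX; case: eqP => [e1 _|_ /eqP]; last by rewrite oner_eq0.
by rewrite e1 e2.
Qed.

(** Replace every monomial of [p] by a chosen monomial of the same weight.  This
    subtracts multiples of binomials of the kernel, and what is left is zero
    because the coefficients add up to zero over each weight class. *)
Lemma toric_ker_span (I : {mpoly K[N]} -> Prop) :
    I 0 -> (forall p q, I p -> I q -> I (p + q)) ->
    (forall c p, I p -> I (c *: p)) ->
    (forall k k', mnm_weight k = mnm_weight k' -> I ('X_[k] - 'X_[k'])) ->
  forall p, toric_map p = 0 -> I p.
Proof.
move=> I0 ID IZ IB p /toric_kerP p0.
pose rep k :=
  nth 0%MM (msupp p) (find (fun k' => mnm_weight k' == mnm_weight k) (msupp p)).
have repP k : k \in msupp p -> mnm_weight (rep k) = mnm_weight k.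
  move=> kp; apply/eqP/(@nth_find _ 0%MM (fun k' => mnm_weight k' == mnm_weight k)).
  by apply/hasP; exists k.
suff -> : p = \sum_(k <- msupp p) p@_k *: ('X_[k] - 'X_[rep k]).
  rewrite big_seq; elim/big_ind: _ => // k kp; apply: IZ; apply: IB.
  by rewrite repP.
under eq_bigr => k _ do rewrite scalerBr.
rewrite sumrB -mpolyE -[LHS]subr0; congr (_ - _); apply/esym.
apply/mpolyP=> r; rewrite raddf_sum mcoeff0 /=.
under eq_bigr => k _ do rewrite mcoeffZ mcoeffX.
have [/hasP[k0 k0p /eqP <-]|/hasPn nr] := boolP (has (fun k => rep k == r) (msupp p)).
  rewrite -[RHS](p0 (mnm_weight k0)) [RHS]big_mkcond /= big_seq [RHS]big_seq.
  apply: eq_bigr => k kp.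
  have -> : (rep k == rep k0) = (mnm_weight k == mnm_weight k0).
    apply/eqP/eqP => [E|E]; last by rewrite /rep E.
    by rewrite -(repP _ kp) E repP.
  by case: eqP; rewrite ?mulr1 ?mulr0.
by rewrite big_seq big1 // => k /nr /negbTE ->; rewrite mulr0.
Qed.

End MonomialMaps.

(** * Ideals and homogeneous polynomials *)
Definition ideal_pred (R : comNzRingType) (J : R -> Prop) : Prop :=
  [/\ J 0, forall p q, J p -> J q -> J (p + q) & forall a p, J p -> J (a * p)].

Lemma ideal_predN (R : comNzRingType) (J : R -> Prop) p :
  ideal_pred J -> J p -> J (- p).
Proof. by case=> _ _ JM Jp; rewrite -mulN1r; apply: JM. Qed.

Lemma ideal_predB (R : comNzRingType) (J : R -> Prop) p q :
  ideal_pred J -> J p -> J q -> J (p - q).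
Proof.
by move=> idJ Jp Jq; have [_ JD _] := idJ; apply: JD => //; apply: ideal_predN.
Qed.

Lemma ideal_predI (R : comNzRingType) (J J' : R -> Prop) :
  ideal_pred J -> ideal_pred J' -> ideal_pred (fun p => J p /\ J' p).
Proof.
move=> [J0 JD JM] [J'0 J'D J'M].
split=> [//|p q [? ?] [? ?]|a p [? ?]]; first by split; [apply: JD | apply: J'D].
by split; [apply: JM | apply: J'M].
Qed.

Section Homogeneous.
Variables (K : fieldType) (N : nat).
Implicit Types p q : {mpoly K[N]}.

Lemma zhomog0 d : zhomog d (0 : {mpoly K[N]}).
Proof. by move=> m; rewrite msupp0. Qed.

Lemma zhomogX k : zhomog (mdeg k)%:Z ('X_[k] : {mpoly K[N]}).
Proof. by move=> m; rewrite msuppX inE => /eqP ->. Qed.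

Lemma zhomogN d p : zhomog d p -> zhomog d (- p).
Proof. by move=> hp m; rewrite (perm_mem (msuppN p)); apply: hp. Qed.

Lemma zhomogD d p q : zhomog d p -> zhomog d q -> zhomog d (p + q).
Proof.
by move=> hp hq m /msuppD_le; rewrite mem_cat => /orP[/hp|/hq].
Qed.

Lemma zhomogM d d' p q : zhomog d p -> zhomog d' q -> zhomog (d + d') (p * q).
Proof.
move=> hp hq m /msuppM_le /allpairsP[[a b] /= [ap bq ->]].
by rewrite mdegD PoszD (hp _ ap) (hq _ bq).
Qed.

Lemma zhomog_mcoeff0 d p : 0 < d -> zhomog d p -> p@_0%MM = 0.
Proof.
move=> d0 hp; apply/eqP; rewrite mcoeff_eq0; apply/negP => /hp E.
by move: d0; rewrite -E mdeg0.
Qed.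

End Homogeneous.

(** * Adding a regular element: the mapping cone *)
Section MappingCone.
Variables (K : fieldType) (N : nat).
Local Notation T := {mpoly K[N]}.

Lemma is_regularity_ext (J J' : T -> Prop) r :
  (forall p, J p <-> J' p) -> is_regularity J r -> is_regularity J' r.
Proof.
move=> JJ' [F Fr].
have surj p : exists v : 'rV_(rk F 0), J' (p - (v *m aug F) 0 0).
  by have [v /JJ'] := aug_surj F p; exists v.
have ex (v : 'rV_(rk F 0)) : J' ((v *m aug F) 0 0) <-> exists w, v = w *m dif F 0.
  by rewrite -JJ'; apply: exact_aug.
by exists (MinGradedResolution (@aug_homog _ _ _ F) (@dif_homog _ _ _ F) surj ex
  (@exact_dif _ _ _ F) (@dif_minimal _ _ _ F)).
Qed.

Variables (J J' : T -> Prop) (f : T) (d : int).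
Hypotheses (idJ : ideal_pred J) (J'E : forall p, J' p <-> exists a, J (p - a * f)).
Hypotheses (d_gt0 : 0 < d) (f_homog : zhomog d f).
Hypothesis f_regular : forall p, J (p * f) -> J p.
Variable F : min_graded_resolution J.

Definition cone_rk i := if i is i'.+1 then (rk F i + rk F i')%N else rk F 0.

Definition cone_deg i : 'I_(cone_rk i) -> int :=
  match i return 'I_(cone_rk i) -> int with
  | 0 => fun k => rdeg k
  | i'.+1 => fun k => match split k with
                      | inl k1 => rdeg k1
                      | inr k2 => rdeg k2 + d
                      end
  end.

(** The cone of the multiplication by [f] on the resolution [F]; the sign
    alternates so that consecutive maps compose to zero. *)
Definition cone_dif i : 'M[T]_(cone_rk i.+1, cone_rk i) :=
  match i return 'M[T]_(cone_rk i.+1, cone_rk i) with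
  | 0 => col_mx (dif F 0) f%:M
  | i'.+1 => block_mx (dif F i'.+1) 0 ((-1) ^+ i'.+1 * f)%:M (dif F i')
  end.

Lemma cone_dif_homog i (j : 'I_(cone_rk i.+1)) (k : 'I_(cone_rk i)) :
  zhomog (cone_deg j - cone_deg k) (cone_dif i j k).
Proof.
have diag n (a b : 'I_n) (e : 'I_n -> int) s :
    zhomog (e a + d - e b) (((-1) ^+ s * f)%:M a b).
  rewrite mxE; case: eqP => [->|_]; last by rewrite mulr0n; apply: zhomog0.
  rewrite mulr1n addrAC subrr add0r -signr_odd.
  by case: odd; rewrite ?expr1 ?expr0 ?mul1r // mulN1r; apply: zhomogN.
case: i j k => [|i] j k /=; rewrite !mxE.
  case: split => l; first exact: dif_homog.
  by have := diag _ l k (@rdeg _ _ _ F 0) 0; rewrite expr0 mul1r.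
case: split => l; rewrite !mxE; case: split => l'; try exact: dif_homog.
- by rewrite mxE; apply: zhomog0.
- exact: (diag _ l l' (@rdeg _ _ _ F i.+1)).
- by rewrite opprD addrACA subrr addr0; apply: dif_homog.
Qed.

Lemma cone_dif_minimal i (j : 'I_(cone_rk i.+1)) (k : 'I_(cone_rk i)) :
  (cone_dif i j k)@_0%MM = 0.
Proof.
have diag n (a b : 'I_n) s : (((-1) ^+ s * f)%:M a b)@_0%MM = 0.
  rewrite mxE; case: eqP => [_|_]; last by rewrite mulr0n mcoeff0.
  rewrite mulr1n -signr_odd; have f0 := zhomog_mcoeff0 d_gt0 f_homog.
  by case: odd; rewrite ?expr1 ?expr0 ?mul1r // mulN1r mcoeffN f0 oppr0.
case: i j k => [|i] j k /=; rewrite !mxE.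
  case: split => l; first exact: dif_minimal.
  by have := diag _ l k 0; rewrite expr0 mul1r.
case: split => l; rewrite !mxE; case: split => l'; try exact: dif_minimal.
- by rewrite mxE mcoeff0.
- exact: diag.
Qed.

Lemma cone_aug_surj p : exists v : 'rV_(rk F 0), J' (p - (v *m aug F) 0 0).
Proof.
have [v Jv] := aug_surj F p; exists v; apply/J'E; exists 0.
by rewrite mul0r subr0.
Qed.

Lemma aug_dif0 (w : 'rV_(rk F 1)) : J ((w *m dif F 0 *m aug F) 0 0).
Proof. by apply/exact_aug; exists w. Qed.

Lemma dif_dif i (w : 'rV_(rk F i.+2)) : w *m dif F i.+1 *m dif F i = 0.
Proof. by apply/exact_dif; exists w. Qed.

(** If [v] maps to [a * f] modulo [J], lift [a] to [u]: then [v - f *: u] maps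
    into [J] and comes from the first map of [F]. *)
Lemma cone_exact_aug (v : 'rV_(rk F 0)) :
  J' ((v *m aug F) 0 0) <-> exists w, v = w *m cone_dif 0.
Proof.
have [J0 JD JM] := idJ.
rewrite J'E; split=> [[a Ja]|[w ->]].
  have [u Ju] := aug_surj F a.
  have : J (((v - f *: u) *m aug F) 0 0).
    have -> : ((v - f *: u) *m aug F) 0 0
        = ((v *m aug F) 0 0 - a * f) + f * (a - (u *m aug F) 0 0).
      by rewrite mulmxBl -scalemxAl !mxE; ring.
    by apply: JD => //; apply: JM.
  move=> /exact_aug[w E]; exists (row_mx w u).
  by rewrite mul_row_col -E -mul_scalar_mx scalar_mxC subrK.
rewrite -[w]hsubmxK mul_row_col mulmxDl mxE scalar_mxC mul_scalar_mx -scalemxAl.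
exists ((rsubmx w *m aug F) 0 0); rewrite [(_ *: _ : matrix _ _ _) _ _]mxE mulrC addrK.
exact: aug_dif0.
Qed.

(** At the first spot a cycle [(v1, v2)] has [f] times the image of [v2] in [J],
    so regularity of [f] makes [v2] a boundary; further up exactness of [F] does
    this.  In both cases the rest of the cycle is then a cycle of [F]. *)
Lemma cone_exact_dif i (v : 'rV_(cone_rk i.+1)) :
  v *m cone_dif i = 0 <-> exists w, v = w *m cone_dif i.+1.
Proof.
have [J0 JD JM] := idJ.
case: i v => [|i] v; rewrite -[v]hsubmxK.
  move: (lsubmx v) (rsubmx v) => {v} v1 v2.
  rewrite [cone_dif 0]/= [cone_dif 1]/= mul_row_col scalar_mxC mul_scalar_mx expr1 mulN1r.
  split=> [E|[w]].
    have /f_regular : J ((v2 *m aug F) 0 0 * f).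
      have := congr1 (fun u => (u *m aug F) 0 0) E.
      rewrite mulmxDl -scalemxAl mul0mx !mxE => /eqP.
      rewrite addrC addr_eq0 mulrC => /eqP ->.
      apply: ideal_predN => //; have := aug_dif0 v1; by rewrite !mxE.
    move=> /exact_aug[w2 E2].
    have : (v1 + f *: w2) *m dif F 0 = 0 by rewrite mulmxDl -scalemxAl -E2.
    move=> /exact_dif[w1 E1]; exists (row_mx w1 w2).
    rewrite mul_row_block mulmx0 add0r -E2 scalar_mxC mul_scalar_mx -E1.
    by rewrite scaleNr addrK.
  rewrite -[w]hsubmxK mul_row_block mulmx0 add0r => /eq_row_mx[-> ->].
  rewrite mulmxDl dif_dif add0r scalar_mxC mul_scalar_mx -scalemxAl scaleNr.
  by rewrite addNr.
move: (lsubmx v) (rsubmx v) => {v} v1 v2.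
rewrite [cone_dif i.+1]/= [cone_dif i.+2]/= mul_row_block mulmx0 add0r.
rewrite scalar_mxC mul_scalar_mx [(-1) ^+ i.+2]exprS mulN1r mulNr.
set g := _ * f.
split=> [|[w]].
  rewrite -[0 in X in X -> _]row_mx0 => /eq_row_mx[E1 /exact_dif[w2 E2]].
have : (v1 + g *: w2) *m dif F i.+1 = 0 by rewrite mulmxDl -scalemxAl -E2.
  move=> /exact_dif[w1 E3]; exists (row_mx w1 w2).
  rewrite mul_row_block mulmx0 add0r -E2 scalar_mxC mul_scalar_mx -E3.
  by rewrite scaleNr addrK.
rewrite -[w]hsubmxK mul_row_block mulmx0 add0r => /eq_row_mx[-> ->].
rewrite mulmxDl !dif_dif add0r scalar_mxC mul_scalar_mx -scalemxAl scaleNr.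
by rewrite addNr row_mx0.
Qed.

Definition cone : min_graded_resolution J' :=
  @MinGradedResolution _ _ J' cone_rk cone_deg (aug F) cone_dif
    (@aug_homog _ _ _ F) cone_dif_homog cone_aug_surj cone_exact_aug
    cone_exact_dif cone_dif_minimal.

End MappingCone.

(** A generator of degree [j] in homological degree [i] of the old resolution
    gives one of degree [j + d] in homological degree [i + 1] of the cone, and
    [d >= 1] makes these decide the maximum. *)
Lemma regularity_add_regular (K : fieldType) (N : nat) (J J' : {mpoly K[N]} -> Prop)
    (f : {mpoly K[N]}) (d r : int) :
    ideal_pred J -> (forall p, J' p <-> exists a, J (p - a * f)) ->
    0 < d -> zhomog d f -> (forall p, J (p * f) -> J p) ->
  is_regularity J r -> is_regularity J' (r + d - 1).
Proof.
move=> idJ J'E d0 hf fr [F [Fle [i0 [k0 Fi0]]]].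
exists (cone idJ J'E d0 hf fr F); split.
  case=> [|i] k /=; first by have := Fle 0%N k; lia.
  by case: split => l; [have := Fle i.+1 l | have := Fle i l]; lia.
exists i0.+1, (rshift _ k0) => /=.
by rewrite (unsplitK (inr _ k0)); lia.
Qed.

Lemma regularity_zero_ideal (K : fieldType) (N : nat) :
  is_regularity (fun p : {mpoly K[N]} => p = 0) 0.
Proof.
pose T := {mpoly K[N]}; pose rk i := (i == 0)%N : nat.
pose dg i (k : 'I_(rk i)) : int := 0.
have h0 (k : 'I_(rk 0)) : zhomog (dg 0%N k) ((1 : 'cV[T]_1) k 0).
  by rewrite !ord1 mxE eqxx => m; rewrite msupp1 inE => /eqP ->; rewrite mdeg0.
have h1 i (j : 'I_(rk i.+1)) (k : 'I_(rk i)) :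
  zhomog (dg _ j - dg _ k) ((0 : 'M[T]_(rk i.+1, rk i)) j k) by case: j.
have s0 (p : T) : exists v : 'rV_(rk 0), (p - (v *m (1 : 'cV_1)) 0 0) = 0.
  by exists p%:M; rewrite mulmx1 mxE eqxx subrr.
have e0 (v : 'rV[T]_(rk 0)) :
    (v *m (1 : 'cV_1)) 0 0 = 0 <-> exists w : 'rV_(rk 1), v = w *m 0.
  rewrite mulmx1; split=> [E|[w ->]]; last by rewrite mulmx0 mxE.
  by exists 0; rewrite mulmx0; apply/rowP=> k; rewrite !mxE !ord1.
have e1 i (v : 'rV[T]_(rk i.+1)) :
    v *m (0 : 'M_(rk i.+1, rk i)) = 0 <-> exists w : 'rV_(rk i.+2), v = w *m 0.
  by split=> _; [exists 0; apply/rowP; case | apply: mulmx0].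
have m0 i (j : 'I_(rk i.+1)) (k : 'I_(rk i)) :
    ((0 : 'M[T]_(rk i.+1, rk i)) j k)@_0%MM = 0.
  by rewrite mxE mcoeff0.
exists (MinGradedResolution h0 h1 s0 e0 e1 m0); split=> [[|i] k /=|].
- by [].
- by case: k.
- by exists 0%N, ord0.
Qed.

(** * Generated ideals and prime kernels *)
Definition in_ideal (R : comNzRingType) (s : seq R) (p : R) : Prop :=
  exists c : nat -> R, p = \sum_(i < size s) c i * s`_i.

Lemma in_ideal_pred (R : comNzRingType) (s : seq R) : ideal_pred (in_ideal s).
Proof.
split=> [|p q [c ->] [c' ->]|a p [c ->]].
- by exists (fun=> 0); rewrite big1 // => i _; rewrite mul0r.
- exists (fun i => c i + c' i); rewrite -big_split /=.
  by apply: eq_bigr => i _; rewrite mulrDl.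
- exists (fun i => a * c i); rewrite mulr_sumr.
  by apply: eq_bigr => i _; rewrite mulrA.
Qed.

Lemma mem_in_ideal (R : comNzRingType) (s : seq R) f : f \in s -> in_ideal s f.
Proof.
move=> fs; exists (fun i => (i == index f s)%:R).
have lt_f : (index f s < size s)%N by rewrite index_mem.
rewrite (bigD1 (Ordinal lt_f)) //= eqxx mul1r nth_index // big1 ?addr0 // => i.
by rewrite -val_eqE /= => /negbTE ->; rewrite mul0r.
Qed.

Lemma in_ideal_le (R : comNzRingType) (s : seq R) (J : R -> Prop) :
  ideal_pred J -> {in s, forall f, J f} -> forall p, in_ideal s p -> J p.
Proof.
move=> [J0 JD JM] sJ p [c ->]; elim/big_ind: _ => // i _.
by apply/JM/sJ/mem_nth.
Qed.

Lemma mulr_eq0_r (R : idomainType) (p q : R) : p * q = 0 -> q != 0 -> p = 0.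
Proof. by move=> /eqP pq0 /negbTE q0; move: pq0; rewrite mulf_eq0 q0 orbF => /eqP. Qed.

Section ToricKernels.
Variables (K : fieldType) (N M : nat) (h : 'I_N -> 'X_{1..M} * nat).

Lemma toric_ker_ideal : ideal_pred (fun p : {mpoly K[N]} => toric_map h p = 0).
Proof.
split=> [|p q p0 q0|a p p0]; first exact: raddf0.
  by rewrite raddfD /= p0 q0 addr0.
by rewrite rmorphM /= p0 mulr0.
Qed.

Lemma toric_ker_prime (p f : {mpoly K[N]}) :
  toric_map h f != 0 -> toric_map h (p * f) = 0 -> toric_map h p = 0.
Proof. by move=> f0; rewrite rmorphM => E; apply: mulr_eq0_r E f0. Qed.

Lemma toric_ker_sub (J : {mpoly K[N]} -> Prop) :
    ideal_pred J ->
    (forall k k', mnm_weight h k = mnm_weight h k' -> J ('X_[k] - 'X_[k'])) ->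
  forall p, toric_map h p = 0 -> J p.
Proof.
case=> J0 JD JM JB; apply: toric_ker_span => // c p Jp.
by rewrite -mul_mpolyC; apply: JM.
Qed.

End ToricKernels.

(** The kernel depends only on which monomials get equal weights. *)
Lemma eq_toric_ker (K : fieldType) N M M' (h : 'I_N -> 'X_{1..M} * nat)
    (h' : 'I_N -> 'X_{1..M'} * nat) :
    (forall k k', mnm_weight h k = mnm_weight h k' <-> mnm_weight h' k = mnm_weight h' k') ->
  forall p : {mpoly K[N]}, toric_map h p = 0 <-> toric_map h' p = 0.
Proof.
move=> hh' p; split.
- apply: (toric_ker_sub (toric_ker_ideal K h')) => k k' /hh' E.
  exact/toric_ker_binomial.
- apply: (toric_ker_sub (toric_ker_ideal K h)) => k k' /hh' E.
  exact/toric_ker_binomial.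
Qed.

Section VariableIdeals.
Variables (K : fieldType) (N : nat) (Z : seq 'I_N).

Definition kill_vars : {mpoly K[N]} -> {mpoly K[N]} :=
  mmap (@mpolyC N K) (fun i => if i \in Z then 0 else 'X_i).

HB.instance Definition _ := GRing.RMorphism.on kill_vars.

Lemma kill_varsX i : kill_vars 'X_i = if i \in Z then 0 else 'X_i.
Proof. by rewrite /kill_vars mmapX mmap1U. Qed.

(** Setting the variables of [Z] to zero changes nothing modulo the ideal they
    generate.  That ideal is therefore the kernel of a morphism to a domain. *)
Lemma kill_vars_in_ideal p :
  in_ideal [seq 'X_i | i <- Z] p <-> kill_vars p = 0.
Proof.
have [I0 ID IM] := in_ideal_pred [seq 'X_i : {mpoly K[N]} | i <- Z].
split=> [|p0].
  apply: (in_ideal_le (J := fun q => kill_vars q = 0)) => [|f /mapP[i iZ ->]];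
    last by rewrite kill_varsX iZ.
  split=> [|q r q0 r0|a q q0]; first exact: raddf0.
    by rewrite raddfD /= q0 r0 addr0.
  by rewrite rmorphM /= q0 mulr0.
suff : in_ideal [seq 'X_i | i <- Z] (p - kill_vars p) by rewrite p0 subr0.
elim/mpolyind: p {p0} => [|c k p _ _ IH]; first by rewrite raddf0 subr0.
rewrite raddfD /= opprD addrACA; apply: (ID) => //.
rewrite -mul_mpolyC rmorphM /= [kill_vars c%:MP]mmapC -mulrBr; apply: (IM).
rewrite mpolyXE_id rmorph_prod /=.
elim/big_ind2: _ => [|q q' r r' Iq Ir|i _]; first by rewrite subrr.
  have -> : q' * r' - q * r = r' * (q' - q) + q * (r' - r) by ring.
  by apply: (ID); apply: (IM).
rewrite rmorphXn /= kill_varsX; case: ifP => iZ; last by rewrite subrr.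
case: (k i) => [|e]; first by rewrite !expr0 subrr.
rewrite expr0n subr0 exprSr; apply/IM/mem_in_ideal/map_f; exact: iZ.
Qed.

End VariableIdeals.

Lemma mpolyX_binomial_eq0 (K : fieldType) N (k k' : 'X_{1..N}) :
  ('X_[k] - 'X_[k'] : {mpoly K[N]}) = 0 -> k = k'.
Proof.
move/eqP; rewrite subr_eq0 => /eqP /(congr1 (mcoeff k)).
by rewrite !mcoeffX eqxx; case: eqP => // _ /eqP; rewrite oner_eq0.
Qed.

(** * Exchanging variables, and the minors of a matrix with two rows *)
Section Exchange.
Variables (K : fieldType) (N : nat).
Local Notation T := {mpoly K[N]}.

Definition quadric (i j k l : 'I_N) : T := 'X_i * 'X_j - 'X_k * 'X_l.

Lemma quadricE i j k l :
  quadric i j k l = 'X_[U_(i) + U_(j)] - 'X_[U_(k) + U_(l)].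
Proof. by rewrite !mpolyXD. Qed.

Lemma quadric_swap i j k l : quadric k l i j = - quadric i j k l.
Proof. by rewrite /quadric opprB. Qed.

Lemma quadric_mulC i j k l : quadric i j k l = quadric j i k l.
Proof. by rewrite /quadric ['X_i * _]mulrC. Qed.

Lemma quadric_mulCr i j k l : quadric i j k l = quadric i j l k.
Proof. by rewrite /quadric ['X_k * _]mulrC. Qed.

Lemma exchange (J : T -> Prop) p q r s (k : 'X_{1..N}) : p != q ->
    (0 < k p)%N -> (0 < k q)%N -> ideal_pred J -> J (quadric p q r s) ->
  exists k2 : 'X_{1..N}, J ('X_[k] - 'X_[k2]) /\
    forall l, (k2 l + ((p == l) + (q == l)) = k l + ((r == l) + (s == l)))%N.
Proof.
move=> pq kp kq [_ _ JM] Jf; pose k0 := (k - (U_(p) + U_(q)))%MM.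
have kE : k = (k0 + (U_(p) + U_(q)))%MM.
  rewrite submK //; apply/mnm_lepP=> l; rewrite mnmDE !mnm1E.
  by case: eqP => [<-|_]; rewrite ?[q == p]eq_sym ?(negbTE pq) //; case: eqP => [<-|].
exists (k0 + (U_(r) + U_(s)))%MM; split.
  by rewrite {1}kE !mpolyXD -mulrBr; apply: JM; rewrite -!mpolyXD -quadricE.
by move=> l; rewrite [in RHS]kE !mnmDE !mnm1E addnAC.
Qed.

(** The distance used is the total excess of [k] over [k'].  The exchange removes
    two units of excess and creates at most one, since [r] or [s] is a variable
    in which [k] falls short. *)
Lemma exchange_closer (J : T -> Prop) p q r s (k k' : 'X_{1..N}) : p != q ->
    (k' p < k p)%N -> (k' q < k q)%N -> (k r < k' r)%N || (k s < k' s)%N ->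
    ideal_pred J -> J (quadric p q r s) ->
  exists k2 : 'X_{1..N}, [/\ J ('X_[k] - 'X_[k2]),
    forall l, (k2 l + ((p == l) + (q == l)) = k l + ((r == l) + (s == l)))%N
    & (\sum_l (k2 l - k' l) < \sum_l (k l - k' l))%N].
Proof.
move=> pq lt_p lt_q lt_rs idJ Jf.
have [||k2 [Jk2 k2E]] := exchange pq _ _ idJ Jf (k := k).
- exact: leq_ltn_trans lt_p.
- exact: leq_ltn_trans lt_q.
exists k2; split=> //.
have sum1 (i : 'I_N) : (\sum_l (i == l) = 1)%N.
  by rewrite (bigD1 i) //= eqxx big1 ?addn0 // => l; rewrite eq_sym => /negbTE ->.
have [t le_t] : exists t, forall l,
    ((k2 l - k' l) + ((p == l) + (q == l)) <= (k l - k' l) + (t == l))%N.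
  case/orP: lt_rs => lt_rs; [exists s | exists r] => l;
  move: pq lt_p lt_q lt_rs (k2E l);
  case: (p =P l) => [Ep|_]; rewrite ?Ep; case: (q =P l) => [Eq|_]; rewrite ?Eq;
  case: (r =P l) => [Er|_]; rewrite ?Er; case: (s =P l) => [Es|_]; rewrite ?Es;
  first [by rewrite eqxx | lia].
have := leq_sum (index_enum _) (P := xpredT) (fun l _ => le_t l).
by rewrite !big_split /= !sum1; lia.
Qed.

End Exchange.

Lemma sum_nat_eq_le (I : finType) (f g : I -> nat) :
  (forall i, f i <= g i)%N -> (\sum_i f i = \sum_i g i)%N -> f =1 g.
Proof.
move=> fg /eqP E i; apply/eqP; move: E.
rewrite (leqif_sum (fun i _ => leqif_eq (fg i))).2 => /forallP/(_ i).
by [].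
Qed.

Section TwoRowMinors.
Variables (K : fieldType) (N r : nat) (x y : 'I_r -> 'I_N).
Hypotheses (x_inj : injective x) (y_inj : injective y).
Hypothesis xy_disj : forall i j, x i != y j.

(** The columns of the matrix are the pairs [(x j, y j)].  Both entries of a
    column get the same exponent vector, and [t] counts the entries of the first
    row, so that the weight of a monomial records the row and column sums of its
    table of exponents. *)
Definition minor_weight (i : 'I_N) : 'X_{1..N} * nat :=
  (U_(if [pick j | y j == i] is Some j then x j else i)%MM, (i \in codom x) : nat).

Lemma minor_weightE k :
  [/\ forall j, (mnm_weight minor_weight k).1 (x j) = (k (x j) + k (y j))%N,
      forall j, (mnm_weight minor_weight k).1 (y j) = 0%N,
      forall l, l \notin codom x -> l \notin codom y ->
        (mnm_weight minor_weight k).1 l = k l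
    & (mnm_weight minor_weight k).2 = (\sum_j k (x j))%N].
Proof.
pose tgt i := if [pick j | y j == i] is Some j then x j else i.
have tgty j : tgt (y j) = x j.
  by rewrite /tgt; case: pickP => [j' /eqP/y_inj -> //|/(_ j)]; rewrite eqxx.
have tgtN i : i \notin codom y -> tgt i = i.
  by rewrite /tgt; case: pickP => // j /eqP <- /negP[]; apply: codom_f.
have xNy j : x j \notin codom y.
  by apply/negP=> /codomP[j' E]; have := xy_disj j j'; rewrite E eqxx.
have w1 l : (mnm_weight minor_weight k).1 l = (\sum_(i | tgt i == l) k i)%N.
  rewrite /= mnm_sumE [RHS]big_mkcond; apply: eq_bigr => i _.
  rewrite mulmnE mnm1E -/(tgt i).
  by case: eqP; rewrite ?mul1n ?mul0n.
split=> [j|j|l lx ly|].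
- rewrite w1 (bigD1 (x j)) ?tgtN ?eqxx //= (bigD1 (y j)) /=; last first.
    by rewrite tgty eqxx eq_sym xy_disj.
  rewrite big1 ?addn0 // => i /andP[/andP[/eqP E ix] iy].
  have [/codomP[j' Ei]|iNy] := boolP (i \in codom y).
    by move: E iy; rewrite Ei tgty => /x_inj ->; rewrite eqxx.
  by move: ix; rewrite -E tgtN ?eqxx.
- rewrite w1 big1 // => i /eqP E.
  have [/codomP[j' Ei]|iNy] := boolP (i \in codom y).
    by have := xy_disj j' j; rewrite -E Ei tgty eqxx.
  by rewrite tgtN // in E; move: iNy; rewrite E codom_f.
- rewrite w1 (big_pred1 l) // => i /=.
  have [/codomP[j' Ei]|iNy] := boolP (i \in codom y); last by rewrite tgtN.
  rewrite Ei tgty; apply/eqP/eqP=> E; first by rewrite -E codom_f in lx.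
  by rewrite -E codom_f in ly.
- rewrite -big_enum -[RHS](big_map x xpredT k) -[map x _]/(codom x) big_uniq /=.
    by rewrite [RHS]big_mkcond; apply: eq_bigr => i _; case: ifP; rewrite ?mul1n.
  by rewrite map_inj_uniq ?enum_uniq.
Qed.

Lemma minor_weightP k k' :
  mnm_weight minor_weight k = mnm_weight minor_weight k' <->
  [/\ forall j, (k (x j) + k (y j) = k' (x j) + k' (y j))%N,
      forall l, l \notin codom x -> l \notin codom y -> k l = k' l
    & (\sum_j k (x j) = \sum_j k' (x j))%N].
Proof.
have [kx ky kl kt] := minor_weightE k; have [kx' ky' kl' kt'] := minor_weightE k'.
split=> [E|[Ex El Et]].
  split=> [j|l lx ly|]; first by rewrite -kx -kx' E.
    by rewrite -kl // -kl' // E.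
  by rewrite -kt -kt' E.
rewrite [mnm_weight _ k]surjective_pairing [mnm_weight _ k']surjective_pairing.
rewrite kt kt' Et; congr (_, _); apply/mnmP => l.
have [/codomP[j ->]|lx] := boolP (l \in codom x); first by rewrite kx kx'.
have [/codomP[j ->]|ly] := boolP (l \in codom y); first by rewrite ky ky'.
by rewrite kl // kl' // El.
Qed.

Definition minor i j : {mpoly K[N]} := quadric K (x i) (y j) (x j) (y i).

Lemma minor_weight_minor i j : toric_map minor_weight (minor i j) = 0.
Proof.
rewrite /minor quadricE; apply/toric_ker_binomial/minor_weightP.
have xE a b : (U_(x a)%MM (x b) = (a == b))%N by rewrite mnm1E (inj_eq x_inj).
have yE a b : (U_(y a)%MM (y b) = (a == b))%N by rewrite mnm1E (inj_eq y_inj).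
have xyE a b : (U_(x a)%MM (y b) = 0)%N by rewrite mnm1E (negbTE (xy_disj _ _)).
have yxE a b : (U_(y a)%MM (x b) = 0)%N.
  by rewrite mnm1E eq_sym (negbTE (xy_disj _ _)).
split=> [l|l lx ly|].
- by rewrite !mnmDE !xE !yE !xyE !yxE; lia.
- have xl a : (x a == l) = false by apply: contraNF lx => /eqP <-; apply: codom_f.
  have yl a : (y a == l) = false by apply: contraNF ly => /eqP <-; apply: codom_f.
  by rewrite !mnmDE !mnm1E !xl !yl.
- have S a b : (\sum_c (U_(x a) + U_(y b))%MM (x c) = 1)%N.
    rewrite (bigD1 a) //= big1 => [|c ca]; rewrite mnmDE xE yxE; first by rewrite eqxx.
    by rewrite eq_sym (negbTE ca).
  by rewrite !S.
Qed.

(** If two tables with the same row and column sums differ, the first row of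
    [k] is too small in some column [j] and too large in some column [i]; the
    second row is then too large in [j], and the minor on the columns [i], [j]
    brings [k] closer to [k']. *)
Lemma minors_span (J : {mpoly K[N]} -> Prop) k k' :
    ideal_pred J -> (forall i j, i != j -> J (minor i j)) ->
    mnm_weight minor_weight k = mnm_weight minor_weight k' ->
  J ('X_[k] - 'X_[k']).
Proof.
move=> idJ minJ; have [J0 JD JM] := idJ.
have [e le_e] := ubnP (\sum_l (k l - k' l))%N.
elim: e => // e IH in k le_e *; move=> E; have [Ex El Et] := (minor_weightP _ _).1 E.
have [/existsP[j lt_j]|/existsPn ge] := boolP [exists j, k (x j) < k' (x j)]%N; last first.
  suff -> : k = k' by rewrite subrr.
  have ex : (fun j => k' (x j)) =1 (fun j => k (x j)).
    by apply: sum_nat_eq_le => // j; rewrite leqNgt ge.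
  apply/mnmP=> l; have [/codomP[j ->]|lx] := boolP (l \in codom x); first by rewrite -[LHS]ex.
  have [/codomP[j ->]|ly] := boolP (l \in codom y); last exact: El.
  by have := Ex j; rewrite -[k (x j)]ex; lia.
have [/existsP[i lt_i]|/existsPn le] := boolP [exists i, k' (x i) < k (x i)]%N; last first.
  have ex : (fun j => k (x j)) =1 (fun j => k' (x j)).
    by apply: sum_nat_eq_le => // i; rewrite leqNgt le.
  by move: lt_j; rewrite [k (x j)]ex ltnn.
have ij : i != j by apply: contraTneq lt_i => ->; rewrite -leqNgt ltnW.
have ltyj : (k' (y j) < k (y j))%N by have := Ex j; lia.
pose J' p := J p /\ toric_map minor_weight p = 0.
have idJ' : ideal_pred J' := ideal_predI idJ (toric_ker_ideal K minor_weight).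
have [|k2 [[Jk2 wk2] _ lt_k2]] := exchange_closer (xy_disj i j) lt_i ltyj _ idJ'
  (conj (minJ _ _ ij) (minor_weight_minor i j)).
  by rewrite lt_j.
rewrite -[_ - _](subrKA 'X_[k2]); apply: (JD) => //.
apply: IH; first exact: leq_trans lt_k2 le_e.
by rewrite -E; apply/esym/toric_ker_binomial; exact: wk2.
Qed.

End TwoRowMinors.

(** * Resolutions given by explicit matrices *)

(** All generators in homological degree [i] have the same degree [dg i], as in
    the two resolutions needed.  Vectors and matrices are functions on natural
    numbers, of which only the entries below the ranks matter: exactness then
    becomes a statement about finitely many named coefficients. *)
Section PureResolutions.
Variables (K : fieldType) (N : nat) (J : {mpoly K[N]} -> Prop).
Local Notation T := {mpoly K[N]}.
Variables (rk1 : nat -> nat) (dg : nat -> int) (A : nat -> nat -> nat -> T).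

Let rk i := if i is i'.+1 then rk1 i' else 1%N.

Hypotheses (dg0 : dg 0 = 0) (dgS : forall i, dg i < dg i.+1).
Hypothesis A_homog : forall i j k, zhomog (dg i.+1 - dg i) (A i j k).
Hypothesis A_gen : forall p,
  J p <-> exists c : nat -> T, p = \sum_(j < rk 1) c j * A 0 j 0.
Hypothesis A_complex : forall i l k, (l < rk i.+2)%N -> (k < rk i)%N ->
  \sum_(j < rk i.+1) A i.+1 l j * A i j k = 0.
Hypothesis A_exact : forall i (c : nat -> T),
  (forall k, (k < rk i)%N -> \sum_(j < rk i.+1) c j * A i j k = 0) ->
  exists c' : nat -> T,
    forall j, (j < rk i.+1)%N -> c j = \sum_(l < rk i.+2) c' l * A i.+1 l j.

Lemma pure_regularity i0 :
    (0 < rk i0)%N -> (forall i, (0 < rk i)%N -> dg i - i%:Z <= dg i0 - i0%:Z) ->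
  is_regularity J (dg i0 - i0%:Z).
Proof.
move=> rk_i0 le_i0; pose deg i (k : 'I_(rk i)) := dg i.
pose D i : 'M[T]_(rk i.+1, rk i) := \matrix_(j, k) A i j k.
have funE n (v : 'rV[T]_n) : exists c : nat -> T, v = \row_j c j.
  exists (fun j => if insub j is Some j' then v 0 j' else 0).
  by apply/rowP=> j; rewrite mxE insubT //= => lt_j; congr (v 0 _); apply: val_inj.
have mulE i (c : nat -> T) :
    (\row_j c j) *m D i = \row_k \sum_(j < rk i.+1) c j * A i j k.
  by apply/rowP=> k; rewrite !mxE; apply: eq_bigr => j _; rewrite !mxE.
have D_homog i j k : zhomog (deg _ j - deg _ k) (D i j k).
  by rewrite mxE; apply: A_homog.
have D_min i j k : (D i j k)@_0%MM = 0.
  by apply: (@zhomog_mcoeff0 _ _ (dg i.+1 - dg i)); rewrite ?subr_gt0 // mxE.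
have aug_h (k : 'I_(rk 0)) : zhomog (deg _ k) ((1 : 'cV[T]_1) k 0).
  by rewrite !ord1 mxE eqxx /deg dg0 => m; rewrite msupp1 inE => /eqP ->; rewrite mdeg0.
have J0 : J 0 by apply/A_gen; exists (fun=> 0); rewrite big1 // => j _; rewrite mul0r.
have surj (p : T) : exists v : 'rV_(rk 0), J (p - (v *m (1 : 'cV_1)) 0 0).
  by exists p%:M; rewrite mulmx1 mxE eqxx subrr.
have ex_aug (v : 'rV[T]_(rk 0)) :
    J ((v *m (1 : 'cV_1)) 0 0) <-> exists w, v = w *m D 0%N.
  rewrite mulmx1 A_gen; split=> [[c Ec]|[w ->]].
    by exists (\row_j c j); rewrite mulE; apply/rowP=> k; rewrite !ord1 mxE.
  by have [c ->] := funE _ w; exists c; rewrite mulE mxE.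
have ex_D i (v : 'rV[T]_(rk i.+1)) : v *m D i = 0 <-> exists w, v = w *m D i.+1.
  split=> [|[w ->]].
    have [c ->] := funE _ v; rewrite mulE => /rowP E.
    have [|c' Ec'] := A_exact (i := i) (c := c).
      by move=> k lt_k; have := E (Ordinal lt_k); rewrite !mxE.
    by exists (\row_l c' l); rewrite mulE; apply/rowP=> j; rewrite !mxE Ec'.
  have [c ->] := funE _ w; rewrite mulE; apply/rowP=> k; rewrite !mxE.
  under eq_bigr => j _ do rewrite !mxE mulr_suml.
  rewrite exchange_big big1 //= => l _.
  under eq_bigr => j _ do rewrite -mulrA.
  by rewrite -mulr_sumr A_complex ?mulr0.
exists (MinGradedResolution aug_h D_homog surj ex_aug ex_D D_min); split.
  by move=> i k; apply: le_i0; apply: leq_ltn_trans (ltn_ord k).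
by exists i0, (Ordinal rk_i0).
Qed.

End PureResolutions.

(** * The Hilbert-Burch complex of a 2 x 3 matrix *)
Section HilbertBurch.
Variable R : idomainType.
Variables a b c u v w : R.
Let m1 := b * w - c * v.
Let m2 := c * u - a * w.
Let m3 := a * v - b * u.

Hypothesis m2_neq0 : m2 != 0.
Hypothesis colon_m3 : forall p, in_ideal [:: c; w] (p * m3) -> in_ideal [:: c; w] p.
Hypothesis m1_m2 : forall p, in_ideal [:: m2] (p * m1) -> in_ideal [:: m2] p.

(** As [m1] and [m2] lie in [(c, w)], modulo which [m3] is regular, [p3] is in
    [(c, w)]; subtracting multiples of the rows makes it zero.  What remains is a
    syzygy of [m1] and [m2], hence a multiple of [(m2, - m1, 0)], which is
    [c] times the second row minus [w] times the first one. *)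
Lemma hilbert_burch_syzygy p1 p2 p3 :
    p1 * m1 + p2 * m2 + p3 * m3 = 0 ->
  exists s t, [/\ p1 = s * a + t * u, p2 = s * b + t * v & p3 = s * c + t * w].
Proof.
move=> E.
have [|d] := colon_m3 (p := p3).
  exists (fun i => nth 0 [:: p1 * v - p2 * u; p2 * a - p1 * b] i).
  rewrite !big_ord_recr big_ord0 /= add0r.
  have -> : p3 * m3 = - (p1 * m1 + p2 * m2).
    by apply/eqP; rewrite -addr_eq0 addrC E.
  by rewrite /m1 /m2; ring.
rewrite !big_ord_recr big_ord0 /= add0r; set s := d 0%N; set t := d 1%N => E3.
pose q1 := p1 - s * a - t * u; pose q2 := p2 - s * b - t * v.
have E12 : q1 * m1 + q2 * m2 = 0.
  by rewrite -E E3 /q1 /q2 /m1 /m2 /m3; ring.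
have [|e] := m1_m2 (p := q1).
  exists (fun=> - q2); rewrite !big_ord_recr big_ord0 /= add0r mulNr.
  by apply/eqP; rewrite -addr_eq0 E12.
rewrite !big_ord_recr big_ord0 /= add0r; set l := e 0%N => E1.
have E2 : q2 = - l * m1.
  apply: (mulIf m2_neq0); apply/eqP; rewrite -subr_eq0; apply/eqP.
  by rewrite -E12 E1; ring.
exists (s - l * w), (t + l * c); split.
- by move: E1; rewrite /q1 /m2 => /eqP; rewrite !subr_eq => /eqP ->; ring.
- by move: E2; rewrite /q2 /m1 => /eqP; rewrite !subr_eq => /eqP ->; ring.
- by rewrite E3; ring.
Qed.

Lemma hilbert_burch_inj s t :
  s * a + t * u = 0 -> s * c + t * w = 0 -> s = 0 /\ t = 0.
Proof.
move=> Ea Ec; split; apply: (mulIf m2_neq0); rewrite mul0r /m2.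
  have -> : s * (c * u - a * w) = u * (s * c + t * w) - w * (s * a + t * u) by ring.
  by rewrite Ea Ec !mulr0 subrr.
have -> : t * (c * u - a * w) = c * (s * a + t * u) - a * (s * c + t * w) by ring.
by rewrite Ea Ec !mulr0 subrr.
Qed.

End HilbertBurch.

Lemma hilbert_burch_regularity (K : fieldType) (N : nat) (J : {mpoly K[N]} -> Prop)
    (a b c u v w : {mpoly K[N]}) :
    {in [:: a; b; c; u; v; w], forall p, zhomog 1 p} ->
    (forall p, J p <-> in_ideal [:: b * w - c * v; c * u - a * w; a * v - b * u] p) ->
    c * u - a * w != 0 ->
    (forall p, in_ideal [:: c; w] (p * (a * v - b * u)) -> in_ideal [:: c; w] p) ->
    (forall p, in_ideal [:: c * u - a * w] (p * (b * w - c * v)) ->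
               in_ideal [:: c * u - a * w] p) ->
  is_regularity J 1.
Proof.
move=> hom JE m2_neq0 colon3 colon1.
have hM p q p' q' : p \in [:: a; b; c; u; v; w] -> q \in [:: a; b; c; u; v; w] ->
    p' \in [:: a; b; c; u; v; w] -> q' \in [:: a; b; c; u; v; w] ->
    zhomog (2%:Z - 0) (p * q - p' * q').
  rewrite subr0; move=> /hom hp /hom hq /hom hp' /hom hq'; apply: zhomogD; last apply: zhomogN.
    exact: (zhomogM hp hq).
  exact: (zhomogM hp' hq').
have hL p : p \in [:: a; b; c; u; v; w] -> zhomog (3%:Z - 2%:Z) p by exact: hom.
pose Ms := [:: [:: [:: b * w - c * v]; [:: c * u - a * w]; [:: a * v - b * u]];
               [:: [:: a; b; c]; [:: u; v; w]]].
have := @pure_regularity K N J (nth 0%N [:: 3; 2]%N)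
  (fun i => if i is 0 then 0 else i.+1%:Z)
  (fun i j k => (nth [::] (nth [::] Ms i) j)`_k) _ _ _ _ _ _ 2%N.
apply => //.
- by case=> [|i] //; rewrite ltz_nat.
- have z0 := @zhomog0 K N.
  case=> [|[|i]] [|[|[|j]]] [|[|[|k]]] //=; rewrite ?nth_nil /= ?nth_nil //;
    first [refine (hL _ _) | refine (hM _ _ _ _ _ _ _ _)]; by rewrite !inE eqxx ?orbT.
- by move=> p; rewrite JE; split=> -[e ->]; exists e; rewrite !big_ord_recr !big_ord0.
- case=> [|i] l k; last by rewrite /= nth_nil.
  by case: l k => [|[|l]] [|k] //= _ _; rewrite !big_ord_recr big_ord0 /=; ring.
- case=> [|[|i]] e E.
  + have := E 0%N isT; rewrite !big_ord_recr big_ord0 /= add0r => /hilbert_burch_syzygy.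
    case=> // s [t [E1 E2 E3]]; exists (nth 0 [:: s; t]).
    by case=> [|[|[|j]]] // _; rewrite !big_ord_recr big_ord0 /= add0r.
  + have [] := @hilbert_burch_inj _ a c u w m2_neq0 (e 0%N) (e 1%N).
    * by have := E 0%N isT; rewrite !big_ord_recr big_ord0 /= add0r.
    * by have := E 2%N isT; rewrite !big_ord_recr big_ord0 /= add0r.
    move=> e0 e1; exists (fun=> 0); case=> [|[|j]] // _; rewrite big_ord0 //.
  + by exists (fun=> 0) => j; rewrite /= nth_nil.
- by case=> [|[|[|i]]] //=; rewrite nth_nil.
Qed.

(** * The Pfaffian complex of the 4-cycle *)

(** The vertices are [a], [b], [c], [d] in cyclic order, and [y1], ..., [y4] are
    the variables of the edges ab, bc, cd, da.  Up to the order of the rows and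
    signs, the five linear syzygies of [f1], ..., [f5] form a skew-symmetric
    matrix with Pfaffians [f1], ..., [f5].  The factors are ordered so that [f5],
    [f4], [f2] are the minors of the matrix with rows [(b, y3, y4)] and
    [(d, y2, y1)], in the convention of the previous part. *)
Section FourCyclePfaffians.
Variable R : idomainType.
Variables a b c d y1 y2 y3 y4 : R.
Let f1 := a * y1 - c * y2.
Let f2 := b * y2 - y3 * d.
Let f3 := c * y3 - a * y4.
Let f4 := y4 * d - b * y1.
Let f5 := y3 * y1 - y4 * y2.

Hypotheses (f4_neq0 : f4 != 0) (f5_neq0 : f5 != 0).
Hypothesis colon_f1 :
  forall p, in_ideal [:: b; y3; y4] (p * f1) -> in_ideal [:: b; y3; y4] p.
Hypothesis colon_f3 :
  forall p, in_ideal [:: f5; f4; f2] (p * f3) -> in_ideal [:: f5; f4; f2] p.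
Hypothesis colon_f2 : forall p, in_ideal [:: y4; y1] (p * f2) -> in_ideal [:: y4; y1] p.
Hypothesis f5_f4 : forall p, in_ideal [:: f4] (p * f5) -> in_ideal [:: f4] p.
Hypothesis f4_f5 : forall p, in_ideal [:: f5] (p * f4) -> in_ideal [:: f5] p.

(** All of [f2], ..., [f5] lie in [(b, y3, y4)], modulo which [f1] is regular, so
    three of the linear syzygies bring [p1] to zero.  Next, [f3] is regular
    modulo the minors [f5], [f4], [f2], and syzygies with first entry zero and
    third entry one of these minors bring the coefficient of [f3] to zero.  The
    remaining relation is a syzygy of the three minors. *)
Lemma pfaffian_syzygy p1 p2 p3 p4 p5 :
    p1 * f1 + p2 * f2 + p3 * f3 + p4 * f4 + p5 * f5 = 0 ->
  exists s1 s2 s3 s4 s5,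
    [/\ p1 = s1 * y3 + s3 * b + s4 * y4, p2 = s2 * y4 + s3 * c + s5 * y1,
        p3 = s1 * y2 + s3 * d + s4 * y1, p4 = s2 * y3 + s3 * a + s5 * y2
      & p5 = - s1 * a + s2 * b - s4 * c + s5 * d].
Proof.
move=> E.
have [|e] := colon_f1 (p := p1).
  exists (nth 0 [:: p4 * y1 - p2 * y2; p2 * d - p3 * c - p5 * y1; p3 * a - p4 * d + p5 * y2]).
  rewrite !big_ord_recr big_ord0 /= add0r.
  have -> : p1 * f1 = - (p2 * f2 + p3 * f3 + p4 * f4 + p5 * f5).
    by apply/eqP; rewrite -addr_eq0 !addrA E.
  by rewrite /f2 /f3 /f4 /f5; ring.
rewrite !big_ord_recr big_ord0 /= add0r.
move: (e 0%N) (e 1%N) (e 2%N) => {e} al be ga E1.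
pose q2 := p2 - al * c; pose q3 := p3 - al * d - be * y2 - ga * y1.
pose q4 := p4 - al * a; pose q5 := p5 + be * a + ga * c.
have Eq : q2 * f2 + q3 * f3 + q4 * f4 + q5 * f5 = 0.
  by rewrite -E E1 /q2 /q3 /q4 /q5 /f1 /f2 /f3 /f4 /f5; ring.
have [|e] := colon_f3 (p := q3).
  exists (nth 0 [:: - q5; - q4; - q2]).
  rewrite !big_ord_recr big_ord0 /= add0r.
  apply/eqP; rewrite -subr_eq0; apply/eqP; rewrite -Eq; ring.
rewrite !big_ord_recr big_ord0 /= add0r.
move: (e 0%N) (e 1%N) (e 2%N) => {e} l5 l4 l2 E3.
have [|s [t [E5 E4 E2]]] := @hilbert_burch_syzygy R b y3 y4 d y2 y1 f4_neq0 colon_f2 f5_f4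
  (q5 + l2 * a * b - l4 * b * c - l5 * (a * y4 - c * y3))
  (q4 + l2 * a * y3 - l4 * a * y4) (q2 + l2 * c * y3 - l4 * c * y4).
  by rewrite -Eq E3 /f2 /f3 /f4 /f5; ring.
(* The coefficients collect the three corrections made above. *)
exists (be + l2 * b - l5 * y4), s, (al - l2 * y3 + l4 * y4), (ga - l4 * b + l5 * y3), t.
split.
- by rewrite E1; ring.
- apply/eqP; rewrite -subr_eq0; apply/eqP; rewrite -(subrr (s * y4 + t * y1)) -{1}E2 /q2.
  by ring.
- have -> : p3 = q3 + al * d + be * y2 + ga * y1 by rewrite /q3; ring.
  by rewrite E3 /f2 /f4 /f5; ring.
- apply/eqP; rewrite -subr_eq0; apply/eqP; rewrite -(subrr (s * y3 + t * y2)) -{1}E4 /q4.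
  by ring.
- apply/eqP; rewrite -subr_eq0; apply/eqP; rewrite -(subrr (s * b + t * d)) -{1}E5 /q5.
  by ring.
Qed.

(** Eliminating [s4], respectively [s1], [s5], [s2], from a pair of the equations
    gives [s1 * f5 = s3 * f4] and its three analogues.  The first of them forces
    [f5] to divide [s3], and the quotient determines everything. *)
Lemma pfaffian_second_syzygy s1 s2 s3 s4 s5 :
    s1 * y3 + s3 * b + s4 * y4 = 0 -> s2 * y4 + s3 * c + s5 * y1 = 0 ->
    s1 * y2 + s3 * d + s4 * y1 = 0 -> s2 * y3 + s3 * a + s5 * y2 = 0 ->
  exists l, [/\ s1 = l * f4, s2 = - l * f1, s3 = l * f5, s4 = l * f2 & s5 = - l * f3].
Proof.
move=> C1 C2 C3 C4.
have [|e] := f4_f5 (p := s3).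
  exists (fun=> s1); rewrite !big_ord_recr big_ord0 /= add0r.
  apply/eqP; rewrite -subr_eq0; apply/eqP.
  transitivity (y4 * (s1 * y2 + s3 * d + s4 * y1) - y1 * (s1 * y3 + s3 * b + s4 * y4)).
    by rewrite /f4 /f5; ring.
  by rewrite C1 C3 !mulr0 subrr.
rewrite !big_ord_recr big_ord0 /= add0r; move: (e 0%N) => l E3.
exists l; split=> //; apply: (mulIf f5_neq0); apply/eqP; rewrite -subr_eq0; apply/eqP.
- transitivity (y1 * (s1 * y3 + s3 * b + s4 * y4) - y4 * (s1 * y2 + s3 * d + s4 * y1)).
    by rewrite E3 /f4 /f5; ring.
  by rewrite C1 C3 !mulr0 subrr.
- transitivity (y1 * (s2 * y3 + s3 * a + s5 * y2) - y2 * (s2 * y4 + s3 * c + s5 * y1)).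
    by rewrite E3 /f1 /f5; ring.
  by rewrite C2 C4 !mulr0 subrr.
- transitivity (y3 * (s1 * y2 + s3 * d + s4 * y1) - y2 * (s1 * y3 + s3 * b + s4 * y4)).
    by rewrite E3 /f2 /f5; ring.
  by rewrite C1 C3 !mulr0 subrr.
- transitivity (y3 * (s2 * y4 + s3 * c + s5 * y1) - y4 * (s2 * y3 + s3 * a + s5 * y2)).
    by rewrite E3 /f3 /f5; ring.
  by rewrite C2 C4 !mulr0 subrr.
Qed.

End FourCyclePfaffians.

Lemma pfaffian_regularity (K : fieldType) (N : nat) (J : {mpoly K[N]} -> Prop)
    (a b c d y1 y2 y3 y4 : {mpoly K[N]}) :
  let f1 := a * y1 - c * y2 in let f2 := b * y2 - y3 * d in
  let f3 := c * y3 - a * y4 in let f4 := y4 * d - b * y1 in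
  let f5 := y3 * y1 - y4 * y2 in
    {in [:: a; b; c; d; y1; y2; y3; y4], forall p, zhomog 1 p} ->
    (forall p, J p <-> in_ideal [:: f1; f2; f3; f4; f5] p) ->
    f4 != 0 -> f5 != 0 ->
    (forall p, in_ideal [:: b; y3; y4] (p * f1) -> in_ideal [:: b; y3; y4] p) ->
    (forall p, in_ideal [:: f5; f4; f2] (p * f3) -> in_ideal [:: f5; f4; f2] p) ->
    (forall p, in_ideal [:: y4; y1] (p * f2) -> in_ideal [:: y4; y1] p) ->
    (forall p, in_ideal [:: f4] (p * f5) -> in_ideal [:: f4] p) ->
    (forall p, in_ideal [:: f5] (p * f4) -> in_ideal [:: f5] p) ->
  is_regularity J 2.
Proof.
move=> f1 f2 f3 f4 f5 hom JE f4_neq0 f5_neq0 colon1 colon3 colon2 f5f4 f4f5.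
have hL p : p \in [:: a; b; c; d; y1; y2; y3; y4] -> zhomog (3%:Z - 2%:Z) p by exact: hom.
have hLN p : p \in [:: a; b; c; d; y1; y2; y3; y4] -> zhomog (3%:Z - 2%:Z) (- p).
  by move=> /hL; apply: zhomogN.
have hM p q p' q' : p \in [:: a; b; c; d; y1; y2; y3; y4] ->
    q \in [:: a; b; c; d; y1; y2; y3; y4] ->
    p' \in [:: a; b; c; d; y1; y2; y3; y4] -> q' \in [:: a; b; c; d; y1; y2; y3; y4] ->
    zhomog 2 (p * q - p' * q').
  move=> /hom hp /hom hq /hom hp' /hom hq'; apply: zhomogD; last apply: zhomogN.
    exact: (zhomogM hp hq).
  exact: (zhomogM hp' hq').
have [h1 h2 h3 h4 h5] : [/\ zhomog 2 f1, zhomog 2 f2, zhomog 2 f3, zhomog 2 f4 & zhomog 2 f5].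
  by split; refine (hM _ _ _ _ _ _ _ _); rewrite !inE eqxx ?orbT.
pose Ms := [:: [:: [:: f1]; [:: f2]; [:: f3]; [:: f4]; [:: f5]];
  [:: [:: y3; 0; y2; 0; - a]; [:: 0; y4; 0; y3; b]; [:: b; c; d; a; 0];
      [:: y4; 0; y1; 0; - c]; [:: 0; y1; 0; y2; d]];
  [:: [:: f4; - f1; f5; f2; - f3]]].
have := @pure_regularity K N J (nth 0%N [:: 5; 5; 1]%N)
  (fun i => match i with 0%N => 0 | 1%N => 2%:Z | 2%N => 3%:Z | _ => i.+2%:Z end)
  (fun i j k => (nth [::] (nth [::] Ms i) j)`_k) _ _ _ _ _ _ 3%N.
apply => //.
- by case=> [|[|[|i]]] //; rewrite ltz_nat.
- have z0 := @zhomog0 K N.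
  have h1N := zhomogN h1; have h3N := zhomogN h3.
  case=> [|[|[|i]]] [|[|[|[|[|j]]]]] [|[|[|[|[|k]]]]] //=; rewrite ?nth_nil /= ?nth_nil //;
    first [ by refine (hLN _ _); rewrite !inE eqxx ?orbT
          | by refine (hL _ _); rewrite !inE eqxx ?orbT].
- by move=> p; rewrite JE; split=> -[e ->]; exists e; rewrite !big_ord_recr !big_ord0.
- case=> [|[|i]] l k; last by rewrite /= nth_nil.
    by case: l k => [|[|[|[|[|l]]]]] [|k] //= _ _;
      rewrite !big_ord_recr big_ord0 /= /f1 /f2 /f3 /f4 /f5; ring.
  by case: l k => [|l] [|[|[|[|[|k]]]]] //= _ _;
    rewrite !big_ord_recr big_ord0 /= /f1 /f2 /f3 /f4 /f5; ring.
- case=> [|[|[|i]]] e E.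
  + have := E 0%N isT; rewrite !big_ord_recr big_ord0 /= add0r => /pfaffian_syzygy.
    case=> // s1 [s2 [s3 [s4 [s5 [E1 E2 E3 E4 E5]]]]]; exists (nth 0 [:: s1; s2; s3; s4; s5]).
    case=> [|[|[|[|[|j]]]]] // _; rewrite !big_ord_recr big_ord0 /=;
      by rewrite ?(E1, E2, E3, E4, E5); ring.
  + have [] := @pfaffian_second_syzygy _ a b c d y1 y2 y3 y4 f5_neq0 f4f5
      (e 0%N) (e 1%N) (e 2%N) (e 3%N) (e 4%N).
    * by have := E 0%N isT; rewrite !big_ord_recr big_ord0 /= => <-; ring.
    * by have := E 1%N isT; rewrite !big_ord_recr big_ord0 /= => <-; ring.
    * by have := E 2%N isT; rewrite !big_ord_recr big_ord0 /= => <-; ring.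
    * by have := E 3%N isT; rewrite !big_ord_recr big_ord0 /= => <-; ring.
    move=> l [E1 E2 E3 E4 E5]; exists (fun=> l).
    case=> [|[|[|[|[|j]]]]] // _; rewrite !big_ord_recr big_ord0 /=;
      by rewrite ?(E1, E2, E3, E4, E5) /f1 /f2 /f3 /f4 /f5; ring.
  + have e0 : e 0%N = 0.
      have := E 2%N isT; rewrite !big_ord_recr big_ord0 /= add0r => ef.
      exact: mulr_eq0_r ef f5_neq0.
    by exists (fun=> 0); case=> [|j] // _; rewrite big_ord0 e0.
  + by exists (fun=> 0) => j; rewrite /= nth_nil.
- by case=> [|[|[|[|i]]]] //=; rewrite nth_nil.
Qed.

(** * The two complexes for distinct variables *)

(** Computations with exponents reduce to boolean equalities between variables;
    [distinct_facts] turns the duplicate-freeness of a list of variables into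
    disequalities, with which [simp_distinct] decides the equalities in the
    goal. *)
Ltac distinct_facts U :=
  rewrite /= !inE !negb_or -?andbA in U;
  repeat (let H := fresh "neq" in case/andP: U => H U).

Ltac simp_distinct :=
  repeat match goal with
  | H : is_true (?x != ?y) |- _ =>
      rewrite ?(negbTE H) ?[y == x]eq_sym ?(negbTE H) /=; clear H
  end.

Ltac by_distinct := rewrite /= ?mnmDE ?mnm1E ?inE ?eqxx; simp_distinct; done.

Local Open Scope nat_scope.

(** Here [p], [q], [r], [s] are the exponents of the edges ab, bc, cd, da in a
    monomial, and the equations say that two monomials have the same weight for
    the 4-cycle.  Unless they are equal, one of the ten exchanges offered by the
    five quadrics and their opposites brings the first closer to the second. *)
Lemma four_cycle_arith (a b c d p q r s a' b' c' d' p' q' r' s' : nat) :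
    p + q + r + s = p' + q' + r' + s' ->
    a + (p' + s') = a' + (p + s) -> b + (p' + q') = b' + (p + q) ->
    c + (q' + r') = c' + (q + r) -> d + (r' + s') = d' + (r + s) ->
  [\/ [\/ [/\ a' < a, p' < p & (c < c') || (q < q')],
          [/\ b' < b, p' < p & (s < s') || (d < d')],
          [/\ b' < b, q' < q & (r < r') || (d < d')]
        | [/\ c' < c, q' < q & (a < a') || (p < p')]],
      [\/ [/\ c' < c, r' < r & (a < a') || (s < s')],
          [/\ r' < r, d' < d & (b < b') || (q < q')],
          [/\ s' < s, d' < d & (b < b') || (p < p')]
        | [/\ a' < a, s' < s & (c < c') || (r < r')]],
      [/\ r' < r, p' < p & (s < s') || (q < q')] \/
      [/\ s' < s, q' < q & (r < r') || (p < p')]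
    | [/\ a = a', b = b', c = c' & d = d'] /\ [/\ p = p', q = q', r = r' & s = s']].
Proof.
move=> E0 Ea Eb Ec Ed.
have [lt1|ge1] := ltnP p' p.
  have [lta|gea] := ltnP a' a; first by apply/Or41/Or41; split=> //; lia.
  have [ltb|geb] := ltnP b' b; first by apply/Or41/Or42; split=> //; lia.
  by apply/Or43; left; split=> //; lia.
have [lt2|ge2] := ltnP q' q.
  have [ltb|geb] := ltnP b' b; first by apply/Or41/Or43; split=> //; lia.
  have [ltc|gec] := ltnP c' c; first by apply/Or41/Or44; split=> //; lia.
  by apply/Or43; right; split=> //; lia.
have [lt3|ge3] := ltnP r' r.
  have [ltc|gec] := ltnP c' c; first by apply/Or42/Or41; split=> //; lia.
  by apply/Or42/Or42; split=> //; lia.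
have [lt4|ge4] := ltnP s' s.
  have [ltd|ged] := ltnP d' d; first by apply/Or42/Or43; split=> //; lia.
  by apply/Or42/Or44; split=> //; lia.
by apply/Or44; split; split; lia.
Qed.

Local Open Scope ring_scope.

Section Quadrics.
Variables (K : fieldType) (N : nat).
Local Notation T := {mpoly K[N]}.

Local Notation quadric := (quadric K).

Lemma quadric_neq0 (i j k l s : 'I_N) :
  (U_(i) + U_(j))%MM s != (U_(k) + U_(l))%MM s -> quadric i j k l != 0.
Proof.
by apply: contraNneq; rewrite quadricE => /mpolyX_binomial_eq0 ->.
Qed.

(** The ideal is prime, and the quadric, which involves no variable of [Z], is
    not in it. *)
Lemma colon_variables (Z : seq 'I_N) (i j k l s : 'I_N) :
    ~~ has (mem Z) [:: i; j; k; l] ->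
    (U_(i) + U_(j))%MM s != (U_(k) + U_(l))%MM s ->
  let I := in_ideal [seq 'X_z : T | z <- Z] in
  forall p, I (p * quadric i j k l) -> I p.
Proof.
move=> /hasPn NZ neq I p /kill_vars_in_ideal E; apply/kill_vars_in_ideal.
move: E; rewrite rmorphM /= => E; apply: mulr_eq0_r E _.
have -> : kill_vars Z (quadric i j k l) = quadric i j k l.
  by rewrite raddfB /= !rmorphM /= !kill_varsX !ifN //; apply: NZ; rewrite !inE eqxx ?orbT.
exact: quadric_neq0 neq.
Qed.

Lemma tnth_rows r (x y : r.-tuple 'I_N) : uniq (x ++ y) ->
  [/\ injective (tnth x), injective (tnth y) & forall u v, tnth x u != tnth y v].
Proof.
rewrite cat_uniq => /and3P[ux /hasPn xy uy]; split; try exact/tuple_uniqP.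
by move=> u v; apply: contraNneq (xy _ (mem_tnth v y)) => <-; apply: mem_tnth.
Qed.

Lemma minors_toric r (x y : r.-tuple 'I_N) (gs : seq T) :
    uniq (x ++ y) ->
    (forall u v : 'I_r, (u < v)%N -> in_ideal gs (minor K (tnth x) (tnth y) u v)) ->
    {in gs, forall g, exists u v, g = minor K (tnth x) (tnth y) u v} ->
  forall p, in_ideal gs p <-> toric_map (minor_weight (tnth x) (tnth y)) p = 0.
Proof.
move=> uxy gm mg p; have [x_inj y_inj xy_disj] := tnth_rows uxy; split.
  apply: (in_ideal_le (toric_ker_ideal K _)).
  by move=> g /mg[u [v ->]]; apply: minor_weight_minor.
apply: (toric_ker_sub (in_ideal_pred gs)) => k1 k2.
apply: (minors_span x_inj y_inj xy_disj (in_ideal_pred gs)) => u v.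
rewrite -val_eqE; case: ltngtP => // uv _; first exact: gm.
have -> : minor K (tnth x) (tnth y) u v = - minor K (tnth x) (tnth y) v u.
  by rewrite /minor -quadric_swap.
by apply: (ideal_predN (in_ideal_pred gs)); apply: gm.
Qed.

(** The ideal is prime; the quadric is not in it, as the exponent of [s] is part
    of the weight and differs in its two terms. *)
Lemma colon_minors r (x y : r.-tuple 'I_N) (I : T -> Prop) (i j k l s : 'I_N) :
    uniq (x ++ y) -> s \notin x ++ y ->
    (U_(i) + U_(j))%MM s != (U_(k) + U_(l))%MM s ->
    (forall p, I p <-> toric_map (minor_weight (tnth x) (tnth y)) p = 0) ->
  forall p, I (p * quadric i j k l) -> I p.
Proof.
move=> uxy sxy neq IE p /IE E; apply/IE; have [x_inj y_inj xy_disj] := tnth_rows uxy.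
move: sxy; rewrite mem_cat negb_or => /andP[sx sy].
apply: toric_ker_prime E; apply/negP=> /eqP; rewrite quadricE.
move/toric_ker_binomial/minor_weightP => [] // _ /(_ s) E _; move/negP: neq; apply.
apply/eqP; apply: E.
  by apply/negP=> /codomP[u Es]; rewrite Es mem_tnth in sx.
by apply/negP=> /codomP[u Es]; rewrite Es mem_tnth in sy.
Qed.

Lemma one_minor_toric (a b c d : 'I_N) : uniq [:: a; b; c; d] ->
  forall p, in_ideal [:: quadric a d b c] p <->
    toric_map (minor_weight (tnth [tuple a; b]) (tnth [tuple c; d])) p = 0.
Proof.
move=> U; apply: minors_toric => //.
  move=> [[|[|u]] Hu] [[|[|v]] Hv] //= _; apply: mem_in_ideal.
  by rewrite inE /minor !(tnth_nth a).
move=> g; rewrite inE => /eqP ->; exists ord0, (lift ord0 ord0).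
by rewrite /minor !(tnth_nth a).
Qed.

Lemma three_minors_toric (a b c u v w : 'I_N) : uniq [:: a; b; c; u; v; w] ->
  forall p, in_ideal [:: quadric b w c v; quadric c u a w; quadric a v b u] p <->
    toric_map (minor_weight (tnth [tuple a; b; c]) (tnth [tuple u; v; w])) p = 0.
Proof.
move=> U; have mN x y (i j : 'I_3) : minor K x y i j = - minor K x y j i.
  by rewrite /minor -quadric_swap.
apply: minors_toric => //.
  case=> -[|[|[|//]]] p; case=> -[|[|[|//]]] q //= _.
  - apply: mem_in_ideal; rewrite !inE /minor !(tnth_nth a).
    by apply/or3P; apply: Or33; apply: eqxx.
  - rewrite mN; apply: (ideal_predN (in_ideal_pred _)).
    apply: mem_in_ideal; rewrite !inE /minor !(tnth_nth a).
    by apply/or3P; apply: Or32; apply: eqxx.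
  - apply: mem_in_ideal; rewrite !inE /minor !(tnth_nth a).
    by apply/or3P; apply: Or31; apply: eqxx.
move=> g; rewrite !inE => /or3P[] /eqP ->.
- by exists (lift ord0 ord0), ord_max; rewrite /minor !(tnth_nth a).
- by exists ord_max, ord0; rewrite /minor !(tnth_nth a).
- by exists ord0, (lift ord0 ord0); rewrite /minor !(tnth_nth a).
Qed.

Lemma zhomog_var i : zhomog 1 ('X_i : T).
Proof. by have := @zhomogX K N U_(i)%MM; rewrite mdeg1. Qed.

Lemma zhomog_quadric (i j k l : 'I_N) : zhomog 2 (quadric i j k l).
Proof.
have hX a b : zhomog 2 ('X_a * 'X_b : T) := zhomogM (@zhomog_var a) (@zhomog_var b).
by apply: zhomogD; [exact: hX | exact/zhomogN/hX].
Qed.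

Lemma two_by_three_regularity (J : T -> Prop) (a b c u v w : 'I_N) :
    uniq [:: a; b; c; u; v; w] ->
    (forall p, J p <->
       in_ideal [:: quadric b w c v; quadric c u a w; quadric a v b u] p) ->
  is_regularity J 1.
Proof.
move=> U JE; distinct_facts U.
apply: (hilbert_burch_regularity (a := 'X_a) (b := 'X_b) (c := 'X_c)
          (u := 'X_u) (v := 'X_v) (w := 'X_w)) => //.
- by move=> p; rewrite !inE => /orP[/eqP->|/orP[/eqP->|/or4P[]/eqP->]]; apply: zhomog_var.
- by apply: (@quadric_neq0 c u a w c); by_distinct.
- by apply: (@colon_variables [:: c; w] a v b u a); by_distinct.
- by apply: (colon_minors (s := b) _ _ _ (one_minor_toric _)); by_distinct.
Qed.

Lemma four_cycle_regularity (J : T -> Prop) (a b c d y1 y2 y3 y4 : 'I_N) :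
    uniq [:: a; b; c; d; y1; y2; y3; y4] ->
    (forall p, J p <->
       in_ideal [:: quadric a y1 c y2; quadric b y2 y3 d; quadric c y3 a y4;
                    quadric y4 d b y1; quadric y3 y1 y4 y2] p) ->
  is_regularity J 2.
Proof.
move=> U JE; distinct_facts U.
apply: (pfaffian_regularity (a := 'X_a) (b := 'X_b) (c := 'X_c) (d := 'X_d)
          (y1 := 'X_y1) (y2 := 'X_y2) (y3 := 'X_y3) (y4 := 'X_y4)) => //.
- move=> p; rewrite !inE => /or4P[/eqP->|/eqP->|/eqP->|/orP[/eqP->|/or4P[]/eqP->]];
  apply: zhomog_var.
- by apply: (@quadric_neq0 y4 d b y1 b); by_distinct.
- by apply: (@quadric_neq0 y3 y1 y4 y2 y3); by_distinct.
- by apply: (@colon_variables [:: b; y3; y4] a y1 c y2 a); by_distinct.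
- by apply: (colon_minors (s := c) _ _ _ (three_minors_toric _)); by_distinct.
- by apply: (@colon_variables [:: y4; y1] b y2 y3 d b); by_distinct.
- by apply: (colon_minors (s := y3) _ _ _ (one_minor_toric _)); by_distinct.
- by apply: (colon_minors (s := b) _ _ _ (one_minor_toric _)); by_distinct.
Qed.

(** The moves are made inside the intersection of [J] with the kernel of [h], so
    that they preserve the weight, and with it the linear equations. *)
Lemma four_cycle_span M (h : 'I_N -> 'X_{1..M} * nat) (J : T -> Prop)
    (a b c d y1 y2 y3 y4 : 'I_N) :
    uniq [:: a; b; c; d; y1; y2; y3; y4] -> ideal_pred J ->
    let I p := J p /\ toric_map h p = 0 in
    [/\ I (quadric a y1 c y2), I (quadric b y2 y3 d), I (quadric c y3 a y4),
        I (quadric y4 d b y1) & I (quadric y3 y1 y4 y2)] ->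
    (forall k k', mnm_weight h k = mnm_weight h k' ->
       [/\ forall l, l \notin [:: a; b; c; d; y1; y2; y3; y4] -> k l = k' l,
           k y1 + k y2 + k y3 + k y4 = k' y1 + k' y2 + k' y3 + k' y4 &
       [/\ k a + (k' y1 + k' y4) = k' a + (k y1 + k y4),
           k b + (k' y1 + k' y2) = k' b + (k y1 + k y2),
           k c + (k' y2 + k' y3) = k' c + (k y2 + k y3) &
           k d + (k' y3 + k' y4) = k' d + (k y3 + k y4)]]%N) ->
  forall p, toric_map h p = 0 -> J p.
Proof.
move=> U idJ I [f1 f2 f3 f4 f5] hP; apply: toric_ker_sub => // k k' E.
have idI : ideal_pred I := ideal_predI idJ (toric_ker_ideal K h).
have IN p q r s : I (quadric p q r s) -> I (quadric r s p q).
  by rewrite [quadric r s p q]quadric_swap; apply: ideal_predN.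
have [e le_e] := ubnP (\sum_l (k l - k' l))%N.
elim: e => // e IH in k le_e E *; have [El E0 [Ea Eb Ec Ed]] := hP _ _ E.
have step p q r s : I (quadric p q r s) -> p != q ->
    [/\ (k' p < k p)%N, (k' q < k q)%N & (k r < k' r)%N || (k s < k' s)%N] ->
  J ('X_[k] - 'X_[k']).
  move=> Iq pq [lt_p lt_q lt_rs].
  have [k2 [[Jk2 hk2] _ lt_k2]] := exchange_closer pq lt_p lt_q lt_rs idI Iq.
  have [_ JD _] := idJ; rewrite -[_ - _](subrKA 'X_[k2]); apply: JD => //.
  apply: IH; first exact: leq_trans lt_k2 le_e.
  by rewrite -E; apply/esym/toric_ker_binomial; exact: hk2.
distinct_facts U.
have [[] | [] | [] | [[Ea' Eb' Ec' Ed'] [E1 E2 E3 E4]]] := four_cycle_arith E0 Ea Eb Ec Ed.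
- by apply: step f1 _.
- by apply: step (IN _ _ _ _ f4) _.
- by apply: step f2 _.
- by apply: step (IN _ _ _ _ f1) _.
- by apply: step f3 _.
- by apply: step (IN _ _ _ _ f2) _; rewrite eq_sym.
- by apply: step f4 _; rewrite eq_sym.
- by apply: step (IN _ _ _ _ f3) _.
- by apply: step f5 _; rewrite eq_sym.
- by apply: step (IN _ _ _ _ f5) _; rewrite eq_sym.
have [J0 _ _] := idJ; suff -> : k = k' by rewrite subrr.
apply/mnmP=> l; have [|/El//] := boolP (l \in [:: a; b; c; d; y1; y2; y3; y4]).
by rewrite !inE => /or4P[/eqP->|/eqP->|/eqP->|/or4P[/eqP->|/eqP->|/eqP->|/orP[]/eqP->]].
Qed.

End Quadrics.

(** * Ideals of induced subgraphs *)
Section Subgraphs.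
Variables (K : fieldType) (n : nat) (e : rel 'I_n).
Local Notation m := #|edge_set e|.
Local Notation T := {mpoly K[n + m]}.
Local Notation xv := (@lshift n m).
Local Notation yv := (@rshift n m).
Local Notation quadric := (quadric K).
Implicit Types (W : {set 'I_n}) (k : 'X_{1..n + m}).

(** Variables outside the subgraph are mapped to themselves, so that a vertex can
    be attached without changing the ring. *)
Definition subgraph_weight W (i : 'I_(n + m)) : 'X_{1..n + m} * nat :=
  match split i with
  | inl v => (U_(xv v)%MM, 0%N)
  | inr j => if edge j \subset W
             then ((\sum_(v in W :\: edge j) U_(xv v))%MM, 1%N)
             else (U_(yv j)%MM, 0%N)
  end.

Definition subgraph_ideal W (p : T) : Prop := toric_map (subgraph_weight W) p = 0.

Lemma subgraph_ideal_pred W : ideal_pred (subgraph_ideal W).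
Proof. exact: toric_ker_ideal. Qed.

Definition inner_degree W k : nat := \sum_(j | edge j \subset W) k (yv j).

Definition vertex_degree W k v : nat :=
  \sum_(j | (edge j \subset W) && (v \in edge j)) k (yv j).

(** In the image of a monomial, the exponent of [x_v] for [v] in [W] is
    [k (xv v) + inner_degree W k - vertex_degree W k v].  The last clause
    compares these exponents for [k] and [k'] without subtraction. *)
Definition same_weight W k k' : Prop :=
  [/\ inner_degree W k = inner_degree W k',
      forall j, ~~ (edge j \subset W) -> k (yv j) = k' (yv j),
      forall v, v \notin W -> k (xv v) = k' (xv v)
    & forall v, v \in W ->
        (k (xv v) + vertex_degree W k' v = k' (xv v) + vertex_degree W k v)%N].

Lemma subgraph_weightE W k :
  [/\ (mnm_weight (subgraph_weight W) k).2 = inner_degree W k,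
      forall j, (mnm_weight (subgraph_weight W) k).1 (yv j)
                = (if edge j \subset W then 0 else k (yv j))%N
    & forall v, ((mnm_weight (subgraph_weight W) k).1 (xv v)
                 + (if v \in W then vertex_degree W k v else 0)
                 = k (xv v) + (if v \in W then inner_degree W k else 0))%N].
Proof.
have splitl v : split (xv v) = inl v := unsplitK (inl v).
have splitr j : split (yv j) = inr j := unsplitK (inr j).
have xvE v v' : (xv v == xv v') = (v == v') := inj_eq (@lshift_inj _ _) v v'.
have yvE j j' : (yv j == yv j') = (j == j') := inj_eq (@rshift_inj _ _) j j'.
have sumU (P : pred 'I_n) v : ((\sum_(v' | P v') U_(xv v'))%MM (xv v) = P v :> nat)%N.
  rewrite mnm_sumE; case Pv: (P v).
    rewrite (bigD1 v) //= mnm1E eqxx big1 // => v' /andP[_ /negbTE nv].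
    by rewrite mnm1E xvE nv.
  rewrite big1 // => v' Pv'; rewrite mnm1E xvE.
  by case: eqP Pv' => // ->; rewrite Pv.
split=> [|j|v].
- rewrite /= big_split_ord /= big1 => [|v _]; last by rewrite /subgraph_weight splitl.
  rewrite add0n /inner_degree [RHS]big_mkcond; apply: eq_bigr => j _.
  by rewrite /subgraph_weight splitr; case: ifP; rewrite ?mul1n.
- rewrite /= mnm_sumE big_split_ord /= big1 => [|v _]; last first.
    by rewrite mulmnE /subgraph_weight splitl mnm1E eq_lrshift.
  rewrite add0n (bigD1 j) //= big1 ?addn0 => [|j' /negbTE nj].
    rewrite mulmnE /subgraph_weight splitr; case: ifP => _ /=; last first.
      by rewrite mnm1E eqxx mul1n.
    by rewrite mnm_sumE big1 // => v _; rewrite mnm1E eq_lrshift.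
  rewrite mulmnE /subgraph_weight splitr; case: ifP => _ /=; last by rewrite mnm1E yvE nj.
  by rewrite mnm_sumE big1 // => v _; rewrite mnm1E eq_lrshift.
- rewrite /= mnm_sumE big_split_ord /= (bigD1 v) //= big1 => [|v' /negbTE nv]; last first.
    by rewrite mulmnE /subgraph_weight splitl mnm1E xvE nv.
  rewrite addn0 mulmnE /subgraph_weight splitl mnm1E eqxx mul1n -addnA; congr (_ + _)%N.
  have yE j : (((subgraph_weight W (yv j)).1 *+ k (yv j))%MM (xv v)
      = if (edge j \subset W) && (v \in W) && (v \notin edge j) then k (yv j) else 0)%N.
    rewrite mulmnE /subgraph_weight splitr; case: ifP => _ /=; last first.
      by rewrite mnm1E eq_rlshift.
    by rewrite sumU inE andbC; case: ifP; rewrite ?mul1n.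
  under eq_bigr => j _ do rewrite yE.
  case: ifP => vW; last by rewrite addn0 big1 // => j _; rewrite andbF.
  rewrite -big_mkcond /inner_degree [RHS](bigID (fun j => v \in edge j)) /= [RHS]addnC.
  by congr (_ + _)%N; apply: eq_bigl => j; rewrite andbT.
Qed.

Lemma subgraph_weightP W k k' :
  mnm_weight (subgraph_weight W) k = mnm_weight (subgraph_weight W) k' <->
  same_weight W k k'.
Proof.
have [kd ky kx] := subgraph_weightE W k; have [kd' ky' kx'] := subgraph_weightE W k'.
split=> [E|[Ed Ey Ex Ev]].
  rewrite E in kd ky kx; have Ed : inner_degree W k = inner_degree W k' by rewrite -kd -kd'.
  split=> // [j jW|v vW|v vW].
  - by have := ky j; rewrite ky' (negbTE jW).
  - by have := kx v; have := kx' v; rewrite (negbTE vW); lia.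
  - by have := kx v; have := kx' v; rewrite vW; lia.
rewrite [mnm_weight _ k]surjective_pairing [mnm_weight _ k']surjective_pairing.
rewrite kd kd' Ed; congr (_, _); apply/mnmP => i; rewrite -[i]splitK.
case: (split i) => [v|j]; rewrite [unsplit _]/=; last first.
  by rewrite ky ky'; case: ifPn => // /Ey.
have arith (w w' x x' D D' B : nat) :
  (w + D = x + B -> w' + D' = x' + B -> x + D' = x' + D -> w = w')%N by lia.
have := kx v; have := kx' v; rewrite Ed; case: ifPn => [/Ev E|/Ex E] E' E''.
  exact: arith E'' E' E.
by apply: arith E'' E' _; rewrite E.
Qed.

(** When all edges are inside [W], no exponent of a [y] survives in the weight,
    and what is left is the image in the Rees algebra. *)
Lemma rees_ideal_subgraph p : rees_ideal p <-> subgraph_ideal [set: 'I_n] p.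
Proof.
pose h (i : 'I_(n + m)) : 'X_{1..n} * nat :=
  match split i with
  | inl v => (U_(v)%MM, 0%N)
  | inr j => ((\sum_(v | v \notin edge j) U_(v))%MM, 1%N)
  end.
have reesE q : @rees_map K n e q = toric_map h q.
  rewrite /rees_map /toric_map /mmap; apply: eq_bigr => k _; congr (_ * _).
  apply: mmap1_eq => i; rewrite /h; case: (split i) => [v|j]; first by rewrite expr0 mulr1.
  rewrite expr1 /comp_edge_gen; congr (_%:P * _).
  by elim/big_ind2: _ => [|k1 a k2 b -> ->|//]; rewrite ?mpolyX0 ?mpolyXD.
have hE k : (mnm_weight h k).2 = (mnm_weight (subgraph_weight setT) k).2 /\
    forall v, (mnm_weight h k).1 v = (mnm_weight (subgraph_weight setT) k).1 (xv v).
  split=> [|v].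
    apply: eq_bigr => i _; rewrite /h /subgraph_weight.
    by case: split => // j; rewrite subsetT.
  rewrite /= !mnm_sumE; apply: eq_bigr => i _; rewrite !mulmnE /h /subgraph_weight.
  have xvE v' : (xv v' == xv v) = (v' == v) := inj_eq (@lshift_inj _ _) v' v.
  case: split => [v'|j]; first by rewrite !mnm1E xvE.
  rewrite subsetT /= !mnm_sumE; congr (_ * _)%N.
  by apply: eq_big => [v'|v' _]; rewrite ?inE ?andbT // !mnm1E xvE.
rewrite /rees_ideal reesE; apply: eq_toric_ker => k k'.
have [h2 h1] := hE k; have [h2' h1'] := hE k'.
have [_ ky _] := subgraph_weightE setT k; have [_ ky' _] := subgraph_weightE setT k'.
split=> E.
  rewrite [mnm_weight _ k]surjective_pairing [mnm_weight _ k']surjective_pairing.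
  rewrite -h2 -h2' E; congr (_, _); apply/mnmP => i; rewrite -[i]splitK.
  by case: (split i) => [v|j]; rewrite [unsplit _]/= -?h1 -?h1' ?E // ky ky' subsetT.
rewrite [mnm_weight _ k]surjective_pairing [mnm_weight _ k']surjective_pairing.
by rewrite h2 h2' E; congr (_, _); apply/mnmP => v; rewrite h1 h1' E.
Qed.

Lemma sum_yvD (P : pred 'I_m) k k' :
  (\sum_(j | P j) (k + k')%MM (yv j)
   = \sum_(j | P j) k (yv j) + \sum_(j | P j) k' (yv j))%N.
Proof. by rewrite -big_split; apply: eq_bigr => j _; rewrite mnmDE. Qed.

Lemma sum_yv_xv (P : pred 'I_m) v : (\sum_(j | P j) U_(xv v)%MM (yv j) = 0)%N.
Proof. by rewrite big1 // => j _; rewrite mnm1E eq_lrshift. Qed.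

Lemma sum_yv_yv (P : pred 'I_m) j : (\sum_(j' | P j') U_(yv j)%MM (yv j') = P j)%N.
Proof.
have yvE j' : (yv j == yv j') = (j == j') := inj_eq (@rshift_inj _ _) j j'.
case Pj: (P j).
  rewrite (bigD1 j) //= mnm1E eqxx big1 // => j' /andP[_ /negbTE nj].
  by rewrite mnm1E yvE eq_sym nj.
by rewrite big1 // => j' Pj'; rewrite mnm1E yvE; case: eqP Pj' => // <-; rewrite Pj.
Qed.

Let xvE v v' : (xv v == xv v') = (v == v') := inj_eq (@lshift_inj _ _) v v'.
Let yvE j j' : (yv j == yv j') = (j == j') := inj_eq (@rshift_inj _ _) j j'.
Let xyE v j : (xv v == yv j) = false := eq_lrshift v j.
Let yxE v j : (yv j == xv v) = false := eq_rlshift j v.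

(** Both monomials are mapped to [t] times the product of the [x_v] with [v] in
    [W] and [v != p]. *)
Lemma adjacent_edges_quadric W p q r j j' :
    edge j = [set p; q] -> edge j' = [set p; r] -> q != p -> r != p ->
    p \in W -> q \in W -> r \in W ->
  subgraph_ideal W (quadric (xv q) (yv j) (xv r) (yv j')).
Proof.
move=> Ej Ej' qp rp pW qW rW; rewrite /subgraph_ideal quadricE.
apply/toric_ker_binomial/subgraph_weightP.
have jW : edge j \subset W by rewrite Ej subUset !sub1set pW.
have j'W : edge j' \subset W by rewrite Ej' subUset !sub1set pW.
split=> [|l lW|v vW|v vW].
- by rewrite /inner_degree !sum_yvD !sum_yv_xv !sum_yv_yv jW j'W.
- rewrite !mnmDE !mnm1E !xyE !yvE.
  by case: eqP lW => [<-|_]; rewrite ?jW //; case: eqP => [<-|_]; rewrite ?j'W.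
- rewrite !mnmDE !mnm1E !yxE !xvE.
  by case: eqP vW => [<-|_]; rewrite ?qW //; case: eqP => [<-|_]; rewrite ?rW.
rewrite /vertex_degree !sum_yvD !sum_yv_xv !sum_yv_yv !mnmDE !mnm1E !yxE !xvE.
rewrite jW j'W Ej Ej' !inE !addn0 !add0n /=.
case: (eqVneq v p) => [->|vp]; first by rewrite (negbTE qp) (negbTE rp).
by rewrite /= ![v == _]eq_sym addnC.
Qed.

Lemma eq_reduced (a b a' b' : nat) :
    (a == 0%N) || (b == 0%N) -> (a' == 0%N) || (b' == 0%N) ->
  (a + b' = a' + b)%N -> a = a' /\ b = b'.
Proof. by case/orP=> /eqP ->; case/orP=> /eqP ->; lia. Qed.

(** * Attaching a vertex with one neighbour *)
Section Attach.
Variables (W : {set 'I_n}) (p q r : 'I_n) (j0 j1 : 'I_m).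
Hypotheses (pW : p \in W) (rW : r \in W) (qW : q \notin W).
Hypotheses (Ej0 : edge j0 = [set p; q]) (Ej1 : edge j1 = [set p; r]) (rp : r != p).
Hypothesis new_edge : forall j, edge j \subset q |: W -> edge j \subset W \/ j = j0.

Let f : T := quadric (xv q) (yv j0) (xv r) (yv j1).

Let j0W : ~~ (edge j0 \subset W).
Proof. by rewrite Ej0 subUset !sub1set (negbTE qW) andbF. Qed.

Let subW' j : (edge j \subset q |: W) = (edge j \subset W) || (j == j0).
Proof.
apply/idP/orP=> [/new_edge[->|->]|[jW|/eqP->]]; [by left | by right | |].
  exact: subset_trans jW (subsetUr _ _).
by rewrite Ej0 subUset !sub1set !inE eqxx pW orbT.
Qed.

Let qp : q != p. Proof. by apply: contraNneq qW => ->. Qed.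

Let inner_degree_attach k :
  inner_degree (q |: W) k = (inner_degree W k + k (yv j0))%N.
Proof.
rewrite /inner_degree (bigD1 j0) ?subW' ?eqxx ?orbT //= addnC; congr (_ + _)%N.
apply: eq_bigl => j; rewrite subW'; case: eqP => [->|_].
  by rewrite (negbTE j0W) ?andbF.
by rewrite orbF ?andbT.
Qed.

Let vertex_degree_attach k v :
  vertex_degree (q |: W) k v
  = (vertex_degree W k v + (if v \in edge j0 then k (yv j0) else 0))%N.
Proof.
rewrite /vertex_degree.
have E (P : pred 'I_m) : (\sum_(j | P j) k (yv j)
   = (\sum_(j | P j && (j != j0)) k (yv j)) + (if P j0 then k (yv j0) else 0))%N.
  case: ifP => P0; first by rewrite (bigD1 j0) //= addnC.
  by rewrite addn0; apply: eq_bigl => j; case: eqP => [->|]; rewrite ?andbT ?andbF.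
rewrite E subW' eqxx orbT /=; congr (_ + _)%N.
apply: eq_bigl => j; rewrite subW'; case: eqP => [->|_].
  by rewrite (negbTE j0W) ?andbF.
by rewrite orbF ?andbT.
Qed.

Let vertex_degree_new k : vertex_degree W k q = 0%N.
Proof.
rewrite /vertex_degree big_pred0 // => j; apply/negbTE/negP=> /andP[/subsetP jW /jW].
by rewrite (negbTE qW).
Qed.

Let f_ker : subgraph_ideal (q |: W) f.
Proof.
by apply: adjacent_edges_quadric Ej0 Ej1 _ _ _ _ _; rewrite ?inE ?eqxx ?pW ?rW ?orbT.
Qed.

(** The ideal is prime, and does not contain [f]: the variable of the new edge
    is still free for [W] and occurs in only one term of [f]. *)
Lemma attach_regular g : subgraph_ideal W (g * f) -> subgraph_ideal W g.
Proof.
apply: toric_ker_prime; rewrite /f quadricE; apply/negP=> /eqP /toric_ker_binomial.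
move=> /subgraph_weightP[_ /(_ _ j0W) + _ _].
rewrite !mnmDE !mnm1E !xyE !yvE eqxx; case: eqP => // E.
by move: j0W; rewrite -E Ej1 subUset !sub1set pW rW.
Qed.

(** Exchanging [x_q y_j0] for [x_r y_j1] until one of [x_q], [y_j0] has exponent
    zero does not change a monomial modulo [I].  For such reduced monomials the
    weight at [q], which is the difference of these two exponents, determines
    both of them, and the other conditions are those for [W]. *)
Lemma attach_span (I : T -> Prop) :
    ideal_pred I -> (forall g, subgraph_ideal W g -> I g) -> I f ->
  forall g, subgraph_ideal (q |: W) g -> I g.
Proof.
move=> idI WI If; apply: (toric_ker_sub idI) => k k' kk'; have [I0 ID IM] := idI.
have reduce (l : 'X_{1..n + m}) : exists l2 : 'X_{1..n + m}, [/\ I ('X_[l] - 'X_[l2]),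
    mnm_weight (subgraph_weight (q |: W)) l = mnm_weight (subgraph_weight (q |: W)) l2
    & (l2 (xv q) == 0%N) || (l2 (yv j0) == 0%N)].
  have [s le_s] := ubnP (l (xv q)); elim: s => // s IH in l le_s *.
  have [x0|x1] := posnP (l (xv q)); first by exists l; rewrite subrr x0.
  have [y0|y1] := posnP (l (yv j0)); first by exists l; rewrite subrr y0 orbT.
  (* Intersecting with the ideal of W + q records that the exchange keeps the weight. *)
  have idI2 := ideal_predI idI (subgraph_ideal_pred (q |: W)).
  have [|l2 [[Il2 wl2] l2E]] := exchange _ x1 y1 idI2 (conj If f_ker); first by rewrite xyE.
  have [|l3 [Il3 wl3 red3]] := IH l2.
    have := l2E (xv q); rewrite !yxE eqxx xvE.
    by have -> : (r == q) = false by [apply: contraNF qW => /eqP <-]; lia.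
  exists l3; split=> //; last by rewrite -wl3; apply/toric_ker_binomial; exact: wl2.
  by rewrite -['X_[l] - _](subrKA 'X_[l2]); apply: ID.
have [l [Il wl redl]] := reduce k; have [l' [Il' wl' redl']] := reduce k'.
have -> : 'X_[k] - 'X_[k'] = ('X_[k] - 'X_[l]) + ('X_[l] - 'X_[l']) - ('X_[k'] - 'X_[l']) :> T.
  by ring.
apply: ideal_predB => //; apply: (ID) => //; apply: WI.
have /subgraph_weightP[Ei Ey Ex Ev] :
    mnm_weight (subgraph_weight (q |: W)) l = mnm_weight (subgraph_weight (q |: W)) l'.
  by rewrite -wl -wl' kk'.
have [Eq E0] : l (xv q) = l' (xv q) /\ l (yv j0) = l' (yv j0).
  have := Ev q (setU11 _ _); rewrite !vertex_degree_attach !vertex_degree_new.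
  by rewrite Ej0 set22 !add0n; apply: eq_reduced.
apply/toric_ker_binomial/subgraph_weightP; split=> [|j jW|v vW|v vW].
- by move: Ei; rewrite !inner_degree_attach E0 => /addIn.
- have [->//|jj0] := eqVneq j j0; apply: Ey.
  by rewrite subW' (negbTE jW) (negbTE jj0).
- have [->//|vq] := eqVneq v q; apply: Ex.
  by rewrite in_setU1 (negbTE vW) (negbTE vq).
- have := Ev v (setU1r _ vW); rewrite !vertex_degree_attach E0 !addnA.
  exact: addIn.
Qed.

Lemma attach_ideal g :
  subgraph_ideal (q |: W) g <-> exists a, subgraph_ideal W (g - a * f).
Proof.
have [J0 JD JM] := subgraph_ideal_pred W.
have sub g' : subgraph_ideal W g' -> subgraph_ideal (q |: W) g'.
  apply: (toric_ker_sub (toric_ker_ideal K _)) => k k' /subgraph_weightP[Ei Ey Ex Ev].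
  apply/toric_ker_binomial/subgraph_weightP.
  have E0 := Ey _ j0W; split=> [|j|v|v].
  - by rewrite !inner_degree_attach Ei E0.
  - by rewrite subW' negb_or => /andP[/Ey].
  - by rewrite in_setU1 negb_or => /andP[_ /Ex].
  - rewrite in_setU1 !vertex_degree_attach E0 !addnA.
    case/orP=> [/eqP->|/Ev->] //.
    by rewrite !vertex_degree_new Ex.
split=> [|[a ga]]; last first.
  have -> : g = (g - a * f) + a * f by ring.
  have [J'0 J'D J'M] := subgraph_ideal_pred (q |: W).
  by apply: J'D; [apply: sub | apply: J'M].
pose I g := exists a, subgraph_ideal W (g - a * f).
have idI : ideal_pred I.
  split=> [|h1 h2 [a1 Ia1] [a2 Ia2]|b h [a Ia]].
  - by exists 0; rewrite mul0r subr0.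
  - exists (a1 + a2).
    have -> : h1 + h2 - (a1 + a2) * f = (h1 - a1 * f) + (h2 - a2 * f) by ring.
    exact: JD _ _ Ia1 Ia2.
  - exists (b * a); have -> : b * h - b * a * f = b * (h - a * f) by ring.
    exact: JM _ _ Ia.
apply: (attach_span idI) => [h Wh|]; last by exists 1; rewrite mul1r subrr.
by exists 0; rewrite mul0r subr0.
Qed.

End Attach.

End Subgraphs.

(** * The starting graphs *)
Section StartingGraphs.
Variables (K : fieldType) (n : nat) (e : rel 'I_n).
Hypothesis He : simple_graph e.
Local Notation m := #|edge_set e|.
Local Notation T := {mpoly K[n + m]}.
Local Notation xv := (@lshift n m).
Local Notation yv := (@rshift n m).
Local Notation quadric := (quadric K).
Implicit Types (W : {set 'I_n}) (k : 'X_{1..n + m}).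

Let e_sym : ssrbool.symmetric e := proj1 He.
Let e_irr : irreflexive e := proj2 He.

Let xvE v v' : (xv v == xv v') = (v == v') := inj_eq (@lshift_inj _ _) v v'.
Let yvE j j' : (yv j == yv j') = (j == j') := inj_eq (@rshift_inj _ _) j j'.
Let xyE v j : (xv v == yv j) = false := eq_lrshift v j.
Let yxE v j : (yv j == xv v) = false := eq_rlshift j v.

Lemma edge_inj : injective (@edge n e).
Proof. exact: enum_val_inj. Qed.

Lemma edgeP (j : 'I_m) : exists x y, e x y /\ edge j = [set x; y].
Proof.
by have /imsetP[[x y]] := enum_valP j; rewrite inE => exy E; exists x, y.
Qed.

Lemma edge_exists x y : e x y -> exists j : 'I_m, edge j = [set x; y].
Proof.
move=> exy; have exyE : [set x; y] \in edge_set e.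
  by apply/imsetP; exists (x, y); rewrite ?inE.
by exists (enum_rank_in exyE [set x; y]); rewrite /edge enum_rankK_in.
Qed.

Lemma adj_neq x y : e x y -> x != y.
Proof. by apply: contraTneq => ->; rewrite e_irr. Qed.

Lemma sum_inner_edges W (s : seq 'I_m) (P : pred 'I_m) k :
    uniq s -> (forall j, (edge j \subset W) = (j \in s)) ->
  (\sum_(j | (edge j \subset W) && P j) k (yv j)
   = \sum_(j <- s) if P j then k (yv j) else 0)%N.
Proof.
move=> us sW; rewrite big_uniq //= big_mkcondr.
by apply: eq_bigl => j; rewrite sW.
Qed.

(** With at most one edge the weight determines the monomial, so the ideal is
    zero. *)
Lemma regularity_at_most_one_edge W :
    (forall j j' : 'I_m, edge j \subset W -> edge j' \subset W -> j = j') ->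
  is_regularity (@subgraph_ideal K n e W) 0.
Proof.
move=> one; apply: is_regularity_ext (regularity_zero_ideal K (n + m)) => p.
split=> [->|]; first exact: raddf0.
apply: (toric_ker_sub (J := fun p => p = 0)).
  by split=> [//|p1 p2 -> ->|a p1 ->]; rewrite ?addr0 ?mulr0.
move=> k k' /subgraph_weightP[Ei Ey Ex Ev].
apply/eqP; rewrite subr_eq0; apply/eqP; congr mpolyX.
have yE j : k (yv j) = k' (yv j).
  have [jW|] := boolP (edge j \subset W); last exact: Ey.
  have sumE l : inner_degree W l = l (yv j).
    rewrite /inner_degree (big_pred1 j) // => j' /=.
    by apply/idP/eqP => [j'W|->//]; apply: one.
  by move: Ei; rewrite !sumE.
apply/mnmP=> i; rewrite -[i]splitK; case: (split i) => [v|j]; last exact: yE.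
rewrite [unsplit _]/=; have [vW|] := boolP (v \in W); last exact: Ex.
have := Ev v vW; have -> : vertex_degree W k' v = vertex_degree W k v.
  by apply: eq_bigr => j _; rewrite yE.
exact: addIn.
Qed.

Lemma edge_eq (j j' : 'I_m) x y :
  edge j' = [set x; y] -> x != y -> x \in edge j -> y \in edge j -> j = j'.
Proof.
move=> Ej' xy xj yj; apply: edge_inj; apply/esym/eqP.
rewrite eqEcard Ej' subUset !sub1set xj yj.
by have [u [v [_ ->]]] := edgeP j; rewrite !cards2 xy; case: eqP.
Qed.

Lemma triangle_edges a b c (jab jbc jac : 'I_m) :
    uniq [:: a; b; c] ->
    edge jab = [set a; b] -> edge jbc = [set b; c] -> edge jac = [set a; c] ->
  forall j : 'I_m, (edge j \subset [set a; b; c]) = (j \in [:: jab; jbc; jac]).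
Proof.
move=> U Eab Ebc Eac j; apply/idP/idP=> [|]; last first.
  by rewrite !inE => /or3P[] /eqP->; rewrite ?Eab ?Ebc ?Eac subUset !sub1set !inE !eqxx ?orbT.
have mem_case x y j' : edge j' = [set x; y] -> x != y -> j' \in [:: jab; jbc; jac] ->
    x \in edge j -> y \in edge j -> j \in [:: jab; jbc; jac].
  by move=> E xy j's xj yj; rewrite (edge_eq E xy xj yj).
have [x [y [exy E]]] := edgeP j; have xy := adj_neq exy; distinct_facts U.
have xj : x \in edge j by rewrite E set21.
have yj : y \in edge j by rewrite E set22.
move: xj yj; rewrite E subUset !sub1set -E => xj yj /andP[].
rewrite !in_setU !in_set1 => xW yW.
have [Mab Mbc Mac] : [/\ jab \in [:: jab; jbc; jac], jbc \in [:: jab; jbc; jac] &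
  jac \in [:: jab; jbc; jac]] by rewrite !inE !eqxx ?orbT.
case/orP: xW => [/orP[]|] /eqP Ex; case/orP: yW => [/orP[]|] /eqP Ey;
move: xy xj yj; rewrite Ex Ey => xy xj yj; first [ by rewrite eqxx in xy
  | exact: (mem_case a b jab) | exact: (mem_case b c jbc) | exact: (mem_case a c jac)].
Qed.

Lemma edge_neq z (j j' : 'I_m) : z \in edge j -> z \notin edge j' -> j != j'.
Proof. by move=> zj; apply: contraNneq => <-. Qed.

Lemma subgraph_same_weight W k k' :
  same_weight W k k' -> subgraph_ideal W ('X_[k] - 'X_[k'] : T).
Proof. by move=> kk'; apply/toric_ker_binomial/subgraph_weightP. Qed.

Lemma triangle_arith (a b c u v w a' b' c' u' v' w' : nat) :
    (w + (u + v) = w' + (u' + v') -> a + (w' + v') = a' + (w + v) ->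
     b + (w' + u') = b' + (w + u) -> c + (u' + v') = c' + (u + v) ->
  [/\ a + u = a' + u', b + v = b' + v', c + w = c' + w' & a + b + c = a' + b' + c'])%N.
Proof. by move=> *; split; lia. Qed.

(** Pair the variable of each vertex with that of the opposite edge.  The exponent
    of [x_v] in the image of a monomial is then a column sum of the resulting
    2 x 3 table, so the ideal is that of the 2-minors. *)
Lemma regularity_triangle a b c :
    uniq [:: a; b; c] -> e a b -> e b c -> e a c ->
  is_regularity (@subgraph_ideal K n e [set a; b; c]) 1.
Proof.
move=> U eab ebc eac.
have [jab Eab] := edge_exists eab; have [jbc Ebc] := edge_exists ebc.
have [jac Eac] := edge_exists eac.
have sW := triangle_edges U Eab Ebc Eac; have U' := U; distinct_facts U'.
have memE := (Eab, Ebc, Eac, in_set2).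
have Uj : uniq [:: jab; jbc; jac].
  have n1 : jab != jbc by apply: (@edge_neq a); rewrite !memE; by_distinct.
  have n2 : jab != jac by apply: (@edge_neq b); rewrite !memE; by_distinct.
  have n3 : jbc != jac by apply: (@edge_neq b); rewrite !memE; by_distinct.
  by rewrite /= !inE negb_or n1 n2 n3.
have Uv : uniq [:: xv a; xv b; xv c; yv jbc; yv jac; yv jab].
  have Uj' := Uj; distinct_facts Uj'.
  by rewrite /= !inE !xvE !yvE !xyE; by_distinct.
have [aW bW cW] : [/\ a \in [set a; b; c], b \in [set a; b; c] & c \in [set a; b; c]].
  by rewrite !inE !eqxx ?orbT.
have sI : ideal_pred (@subgraph_ideal K n e [set a; b; c]) by exact: subgraph_ideal_pred.
apply: (two_by_three_regularity Uv) => p; split.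
  move=> Ip; apply/three_minors_toric => //; move: p Ip.
  apply: (toric_ker_sub (toric_ker_ideal K _)) => k k' /subgraph_weightP[Ei Ey Ex Ev].
  have [x_inj y_inj xy_disj] :=
    tnth_rows (x := [tuple xv a; xv b; xv c]) (y := [tuple yv jbc; yv jac; yv jab]) Uv.
  apply/toric_ker_binomial/(minor_weightP x_inj y_inj xy_disj).
  have sumE (P : pred 'I_m) (l : 'X_{1..n + m}) :
      (\sum_(j | (edge j \subset [set a; b; c]) && P j) l (yv j)
      = (if P jab then l (yv jab) else 0) + ((if P jbc then l (yv jbc) else 0)
        + (if P jac then l (yv jac) else 0)))%N.
    by rewrite (sum_inner_edges P l Uj sW) !big_cons big_nil addn0.
  have innerE (l : 'X_{1..n + m}) :
      inner_degree [set a; b; c] l = (l (yv jab) + (l (yv jbc) + l (yv jac)))%N.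
    by rewrite -(sumE xpredT); apply: eq_bigl => j; rewrite andbT.
  have [da db dc] : [/\
      forall l, vertex_degree [set a; b; c] l a = (l (yv jab) + l (yv jac))%N,
      forall l, vertex_degree [set a; b; c] l b = (l (yv jab) + l (yv jbc))%N &
      forall l, vertex_degree [set a; b; c] l c = (l (yv jbc) + l (yv jac))%N].
    by split=> l; rewrite /vertex_degree (sumE (fun j => _ \in edge j)) !memE ?eqxx;
      simp_distinct; rewrite ?orbT ?addn0 ?add0n.
  move: Ei (Ev a aW) (Ev b bW) (Ev c cW); rewrite !innerE !da !db !dc => Ei Ea Eb Ec.
  have [E1 E2 E3 E4] := triangle_arith Ei Ea Eb Ec.
  split=> [j|i|].
  - case: j => -[|[|[|//]]] j3; rewrite !(tnth_nth (xv a)) /=.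
    + exact: E1.
    + exact: E2.
    + exact: E3.
  - rewrite -[i]splitK; case: (split i) => [v|j]; rewrite [unsplit _]/= => ix iy.
      apply: Ex; apply: contra ix; rewrite !inE => /orP[/orP[]|] /eqP ->.
      + by apply/codomP; exists ord0; rewrite (tnth_nth (xv a)).
      + by apply/codomP; exists (lift ord0 ord0); rewrite (tnth_nth (xv a)).
      + by apply/codomP; exists ord_max; rewrite (tnth_nth (xv a)).
    apply: Ey; apply: contra iy; rewrite sW !inE => /or3P[] /eqP ->.
    + by apply/codomP; exists ord_max; rewrite (tnth_nth (xv a)).
    + by apply/codomP; exists ord0; rewrite (tnth_nth (xv a)).
    + by apply/codomP; exists (lift ord0 ord0); rewrite (tnth_nth (xv a)).
  - rewrite !big_ord_recr !big_ord0 !(tnth_nth (xv a)) /=.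
    by rewrite !add0n.
apply: (in_ideal_le sI) => g; rewrite !inE => /or3P[] /eqP -> {g}.
- by apply: (@adjacent_edges_quadric K n e _ a b c jab jac) => //; rewrite eq_sym.
- by apply: (@adjacent_edges_quadric K n e _ b c a jbc jab) => //;
    rewrite ?Eab 1?setUC // eq_sym.
- by apply: (@adjacent_edges_quadric K n e _ c a b jac jbc) => //; rewrite ?Eac ?Ebc setUC.
Qed.

Lemma four_cycle_edges a b c d (jab jbc jcd jda : 'I_m) :
    uniq [:: a; b; c; d] -> ~~ e a c -> ~~ e b d ->
    edge jab = [set a; b] -> edge jbc = [set b; c] ->
    edge jcd = [set c; d] -> edge jda = [set d; a] ->
  forall j : 'I_m,
    (edge j \subset [set a; b; c; d]) = (j \in [:: jab; jbc; jcd; jda]).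
Proof.
move=> U Nac Nbd Eab Ebc Ecd Eda j; apply/idP/idP=> [|]; last first.
  rewrite !inE => /or4P[] /eqP->; rewrite ?Eab ?Ebc ?Ecd ?Eda subUset !sub1set !inE;
    by rewrite ?eqxx ?orbT.
have mem_case x y j' : edge j' = [set x; y] -> x != y ->
    j' \in [:: jab; jbc; jcd; jda] -> x \in edge j -> y \in edge j ->
    j \in [:: jab; jbc; jcd; jda].
  by move=> E xy j's xj yj; rewrite (edge_eq E xy xj yj).
have [x [y [exy E]]] := edgeP j; have xy := adj_neq exy; distinct_facts U.
have da : d != a by rewrite eq_sym.
have Nca : ~~ e c a by rewrite e_sym.
have Ndb : ~~ e d b by rewrite e_sym.
have xj : x \in edge j by rewrite E set21.
have yj : y \in edge j by rewrite E set22.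
move: xj yj; rewrite E subUset !sub1set -E => xj yj /andP[].
rewrite !in_setU !in_set1 => xW yW.
have [Mab Mbc Mcd Mda] : [/\ jab \in [:: jab; jbc; jcd; jda],
  jbc \in [:: jab; jbc; jcd; jda], jcd \in [:: jab; jbc; jcd; jda] &
  jda \in [:: jab; jbc; jcd; jda]] by rewrite !inE !eqxx ?orbT.
case/orP: xW => [/orP[/orP[]|]|] /eqP Ex; case/orP: yW => [/orP[/orP[]|]|] /eqP Ey;
move: exy xy xj yj; rewrite Ex Ey => exy xy xj yj; first [ by rewrite eqxx in xy
  | by rewrite exy in Nac | by rewrite exy in Nbd
  | by rewrite exy in Nca | by rewrite exy in Ndb
  | exact: (mem_case a b jab) | exact: (mem_case b c jbc) | exact: (mem_case c d jcd)
  | exact: (mem_case d a jda)].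
Qed.

Lemma regularity_four_cycle a b c d :
    uniq [:: a; b; c; d] -> e a b -> e b c -> e c d -> e d a -> ~~ e a c -> ~~ e b d ->
  is_regularity (@subgraph_ideal K n e [set a; b; c; d]) 2.
Proof.
move=> U eab ebc ecd eda Nac Nbd.
have [j1 E1] := edge_exists eab; have [j2 E2] := edge_exists ebc.
have [j3 E3] := edge_exists ecd; have [j4 E4] := edge_exists eda.
have sW := four_cycle_edges U Nac Nbd E1 E2 E3 E4; have U' := U; distinct_facts U'.
have memE := (E1, E2, E3, E4, in_set2).
have Uj : uniq [:: j1; j2; j3; j4].
  have n1 : j1 != j2 by apply: (@edge_neq a); rewrite !memE; by_distinct.
  have n2 : j1 != j3 by apply: (@edge_neq a); rewrite !memE; by_distinct.
  have n3 : j1 != j4 by apply: (@edge_neq b); rewrite !memE; by_distinct.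
  have n4 : j2 != j3 by apply: (@edge_neq b); rewrite !memE; by_distinct.
  have n5 : j2 != j4 by apply: (@edge_neq b); rewrite !memE; by_distinct.
  have n6 : j3 != j4 by apply: (@edge_neq c); rewrite !memE; by_distinct.
  by rewrite /= !inE !negb_or n1 n2 n3 n4 n5 n6.
have Uv : uniq [:: xv a; xv b; xv c; xv d; yv j1; yv j2; yv j3; yv j4].
  have Uj' := Uj; distinct_facts Uj'.
  by rewrite /= !inE !xvE !yvE !xyE; by_distinct.
set W := [set a; b; c; d].
have [aW bW cW dW] : [/\ a \in W, b \in W, c \in W & d \in W].
  by rewrite !inE !eqxx ?orbT.
have sI : ideal_pred (@subgraph_ideal K n e W) by exact: subgraph_ideal_pred.
have sumE (P : pred 'I_m) (l : 'X_{1..n + m}) : (\sum_(j | (edge j \subset W) && P j) l (yv j)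
    = (if P j1 then l (yv j1) else 0) + ((if P j2 then l (yv j2) else 0)
      + ((if P j3 then l (yv j3) else 0) + (if P j4 then l (yv j4) else 0))))%N.
  by rewrite (sum_inner_edges P l Uj sW) !big_cons big_nil addn0.
have innerE (l : 'X_{1..n + m}) :
    inner_degree W l = (l (yv j1) + l (yv j2) + l (yv j3) + l (yv j4))%N.
  by rewrite -!addnA -(sumE xpredT); apply: eq_bigl => j; rewrite andbT.
have [da db dc dd] : [/\ forall l, vertex_degree W l a = (l (yv j1) + l (yv j4))%N,
    forall l, vertex_degree W l b = (l (yv j1) + l (yv j2))%N,
    forall l, vertex_degree W l c = (l (yv j2) + l (yv j3))%N &
    forall l, vertex_degree W l d = (l (yv j3) + l (yv j4))%N].
  by split=> l; rewrite /vertex_degree (sumE (fun j => _ \in edge j)) !memE ?eqxx;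
    simp_distinct; rewrite ?orbT ?addn0 ?add0n.
have k1 : subgraph_ideal W (quadric (xv a) (yv j1) (xv c) (yv j2)).
  by apply: (@adjacent_edges_quadric K n e W b a c j1 j2) => //; rewrite ?E1 1?setUC // eq_sym.
have k2 : subgraph_ideal W (quadric (xv b) (yv j2) (yv j3) (xv d)).
  rewrite quadric_mulCr.
  by apply: (@adjacent_edges_quadric K n e W c b d j2 j3) => //; rewrite ?E2 1?setUC // eq_sym.
have k3 : subgraph_ideal W (quadric (xv c) (yv j3) (xv a) (yv j4)).
  by apply: (@adjacent_edges_quadric K n e W d c a j3 j4) => //; rewrite ?E3 1?setUC // eq_sym.
have k4 : subgraph_ideal W (quadric (yv j4) (xv d) (xv b) (yv j1)).
  rewrite quadric_mulC.
  by apply: (@adjacent_edges_quadric K n e W a d b j4 j1) => //; rewrite ?E4 1?setUC // eq_sym.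
have k5 : subgraph_ideal W (quadric (yv j3) (yv j1) (yv j4) (yv j2)).
  have Uj' := Uj; distinct_facts Uj'.
  rewrite quadricE; apply: subgraph_same_weight; split=> [|j|v vW|v].
  - by rewrite !innerE !mnmDE !mnm1E !yvE ?eqxx; simp_distinct.
  - rewrite sW => jN; distinct_facts jN.
    by rewrite !mnmDE !mnm1E !yvE; simp_distinct.
  - by rewrite !mnmDE !mnm1E !yxE.
  - rewrite !inE -!orbA => /or4P[] /eqP ->;
    rewrite ?da ?db ?dc ?dd !mnmDE !mnm1E !yxE !yvE ?eqxx;
    by simp_distinct.
apply: (four_cycle_regularity Uv) => p; split.
  move: p; set gs := [:: _; _; _; _; _].
  have [g1 g2 g3 g4 g5] : [/\ in_ideal gs (quadric (xv a) (yv j1) (xv c) (yv j2)),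
      in_ideal gs (quadric (xv b) (yv j2) (yv j3) (xv d)),
      in_ideal gs (quadric (xv c) (yv j3) (xv a) (yv j4)),
      in_ideal gs (quadric (yv j4) (xv d) (xv b) (yv j1)) &
      in_ideal gs (quadric (yv j3) (yv j1) (yv j4) (yv j2))].
    split.
    - exact: (mem_in_ideal (mem_nth 0 (n := 0) (s := gs) isT)).
    - exact: (mem_in_ideal (mem_nth 0 (n := 1) (s := gs) isT)).
    - exact: (mem_in_ideal (mem_nth 0 (n := 2) (s := gs) isT)).
    - exact: (mem_in_ideal (mem_nth 0 (n := 3) (s := gs) isT)).
    - exact: (mem_in_ideal (mem_nth 0 (n := 4) (s := gs) isT)).
  apply: (four_cycle_span Uv (in_ideal_pred gs)).
    exact: And5 (conj g1 k1) (conj g2 k2) (conj g3 k3) (conj g4 k4) (conj g5 k5).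
  move=> k k' /subgraph_weightP[Ei Ey Ex Ev].
  move: Ei (Ev a aW) (Ev b bW) (Ev c cW) (Ev d dW); rewrite !innerE !da !db !dc !dd.
  move=> Ei Ea Eb Ec Ed; split=> // l; rewrite -[l]splitK.
  case: (split l) => [v|j]; rewrite [unsplit _]/= => lN.
    apply: Ex; apply: contra lN; rewrite !inE !xvE -!orbA => /or4P[] -> ; rewrite ?orbT //.
  apply: Ey; apply: contra lN; rewrite sW !inE !yvE => /or4P[] -> ; rewrite ?orbT //.
apply: (in_ideal_le sI) => g; rewrite !inE.
by move=> /orP[|/or4P[]] /eqP -> {g}.
Qed.

End StartingGraphs.

(** * Reaching all vertices of a connected graph *)
Section Attaching.
Variables (K : fieldType) (n : nat) (e : rel 'I_n).
Hypothesis He : simple_graph e.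
Local Notation m := #|edge_set e|.
Implicit Types (W : {set 'I_n}).

Let e_sym : ssrbool.symmetric e := proj1 He.

Definition induced_rel W : rel 'I_n := [rel x y | [&& e x y, x \in W & y \in W]].

Definition induced_connected W : Prop :=
  exists2 r, r \in W & {in W, forall x, connect (induced_rel W) r x}.

Definition regularity_le_card W : Prop :=
  exists r : int, is_regularity (@subgraph_ideal K n e W) r /\ r <= #|W|%:Z.

Lemma induced_connect_sym W : connect_sym (induced_rel W).
Proof.
by apply: sym_connect_sym => x y; rewrite /induced_rel /= e_sym [(x \in W) && _]andbC.
Qed.

Lemma induced_connected2 W x y :
  induced_connected W -> x \in W -> y \in W -> connect (induced_rel W) x y.
Proof.
case=> r rW Wr xW yW; apply: connect_trans (Wr y yW).
by rewrite induced_connect_sym Wr.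
Qed.

Lemma induced_path_sub W x s : path (induced_rel W) x s -> {subset s <= W}.
Proof.
elim: s x => // y s IH x /= /andP[/and3P[_ _ yW] /IH sW] z.
by rewrite inE => /orP[/eqP->|/sW].
Qed.

Lemma induced_path W x s : path (induced_rel W) x s -> path e x s.
Proof. by apply: sub_path => y z /and3P[]. Qed.

(** With a path from [p] to [p'] inside [W], the vertex [q] would form a cycle
    that is not contained in [W0]. *)
Lemma new_neighbour_uniq W W0 p p' q :
    induced_connected W -> W0 \subset W ->
    (forall C, graph_cycle e C -> {in C, forall S : {set 'I_n}, S \subset W0}) ->
    p \in W -> p' \in W -> q \notin W -> e p q -> e p' q -> p' = p.
Proof.
move=> cW W0W cyc pW p'W qW epq ep'q; apply/eqP/negPn/negP=> p'p.
have /connectP[s0 s0P lastE] := induced_connected2 cW pW p'W.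
case/shortenP: s0P lastE => s sP us _ lastE.
have sW := induced_path_sub sP.
have s_nil : s != [::] by apply: contraNneq p'p => snil; rewrite lastE snil.
pose c := q :: p :: s.
have qps : q \notin p :: s.
  apply/negP; rewrite inE => /orP[/eqP qp|/sW]; last by rewrite (negbTE qW).
  by rewrite qp pW in qW.
have cP : ucycle e c.
  rewrite /ucycle /c cons_uniq qps us andbT /= rcons_path e_sym epq (induced_path sP) /=.
  by rewrite -lastE ep'q.
have cC : graph_cycle e [set [set x; next c x] | x in c].
  by exists c; split; [rewrite /c /= !ltnS lt0n size_eq0 | exact: cP |].
have qC : [set q; next c q] \in [set [set x; next c x] | x in c].
  by apply: imset_f; rewrite inE eqxx.
have := subset_trans (cyc _ cC _ qC) W0W.
by rewrite subUset sub1set (negbTE qW).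
Qed.

Lemma regularity_attach W W0 q p :
    induced_connected W -> W0 \subset W ->
    (forall C, graph_cycle e C -> {in C, forall S : {set 'I_n}, S \subset W0}) ->
    p \in W -> q \notin W -> e p q ->
  regularity_le_card W -> regularity_le_card (q |: W).
Proof.
move=> cW W0W cyc pW qW epq [r [rW le_r]].
have [j0 E0] := edge_exists epq.
have edge_new (j : 'I_m) : edge j \subset q |: W -> edge j \subset W \/ j = j0.
  have [x [y [exy E]]] := edgeP j; rewrite E !subUset !sub1set !in_setU1.
  have xy := adj_neq He exy => /andP[].
  have nb z : e z q -> z \in W -> edge j = [set z; q] -> j = j0.
    move=> ezq zW Ez; apply: edge_inj.
    by rewrite Ez E0 (new_neighbour_uniq cW W0W cyc pW zW qW epq ezq).
  case/orP=> [/eqP xq|xW]; case/orP=> [/eqP yq|yW].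
  - by rewrite xq yq eqxx in xy.
  - by right; apply: (nb y) => //; rewrite -?xq ?[e y x]e_sym // E setUC.
  - by right; apply: (nb x) => //; rewrite -?yq.
  - by left; rewrite xW yW.
have cardW : #|q |: W| = #|W|.+1 by rewrite cardsU1 qW.
have [/existsP[s /andP[sW sp]]|/existsPn noW] :=
    boolP [exists s, (s \in W) && (s != p)]; last first.
  (* W = {p}: the new edge is the only one, and there is still no relation. *)
  exists 0; split; last by rewrite cardW.
  apply: regularity_at_most_one_edge => //.
  have W1 (j : 'I_m) : ~~ (edge j \subset W).
    have [x [y [exy ->]]] := edgeP j; rewrite subUset !sub1set.
    have xy := adj_neq He exy; apply/negP=> /andP[xW yW].
    have := noW x; have := noW y; rewrite xW yW !negbK /= => /eqP yp /eqP xp.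
    by rewrite xp yp eqxx in xy.
  move=> j j' /edge_new[|->]; first by rewrite (negbTE (W1 j)).
  by move=> /edge_new[|->//]; rewrite (negbTE (W1 j')).
have /connectP[[|t u] /= tP lastE] := induced_connected2 cW pW sW.
  by rewrite lastE eqxx in sp.
have /andP[/and3P[ept _ tW] _] := tP; have [j1 E1] := edge_exists ept.
exists (r + 2 - 1); split; last by rewrite cardW -addrA intS addrC lerD2l.
have tp : t != p by rewrite eq_sym (adj_neq He).
refine (regularity_add_regular (@subgraph_ideal_pred K n e W) _ _
          (@zhomog_quadric K _ _ _ _ _) _ rW).
- exact: (attach_ideal pW tW qW E0 E1 tp edge_new).
- by [].
- exact: (attach_regular pW tW qW E0 E1).
Qed.

Lemma regularity_le_order W0 :
    (forall x y, connect e x y) ->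
    (forall C, graph_cycle e C -> {in C, forall S : {set 'I_n}, S \subset W0}) ->
    induced_connected W0 -> regularity_le_card W0 ->
  regularity_le_card setT.
Proof.
move=> conn cyc.
suff grow W : W0 \subset W -> induced_connected W -> regularity_le_card W ->
    regularity_le_card setT.
  by move=> cW0 rW0; apply: (grow W0).
have [s le_s] := ubnP #|~: W|; elim: s => // s IH in W le_s * => W0W cW rW.
have [/eqP WT|] := boolP (W == setT); first by rewrite -WT.
rewrite eqEsubset subsetT /= => /subsetPn[u _ uW].
have [/existsP[p /existsP[q /and3P[pW qW epq]]]|/existsPn none] :=
    boolP [exists p, [exists q, [&& p \in W, q \notin W & e p q]]]; last first.
  have [x xW _] := cW; have clW : closed e (mem W).
    move=> y z eyz; apply/idP/idP => [yW|zW]; apply/negPn/negP=> N.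
      by have /existsPn/(_ z) := none y; rewrite /= in yW N *; rewrite yW N eyz.
    by have /existsPn/(_ y) := none z; rewrite /= in zW N *; rewrite zW N e_sym eyz.
  by have := closed_connect clW (conn x u); rewrite /= xW (negbTE uW).
apply: (IH (q |: W)); last exact: regularity_attach cW W0W cyc pW qW epq rW.
- rewrite -ltnS; apply: leq_trans le_s; rewrite ltnS; apply: proper_card.
  by rewrite properC setUC; apply: properUl; rewrite sub1set.
- exact: subset_trans W0W (subsetUr _ _).
have [x xW Wx] := cW; exists x; first by rewrite inE xW orbT.
have up y z : connect (induced_rel W) y z -> connect (induced_rel (q |: W)) y z.
  apply: connect_sub => {}y {}z /and3P[eyz yW zW]; apply: connect1.
  by rewrite /induced_rel /= eyz !in_setU1 yW zW !orbT.
move=> z; rewrite in_setU1 => /orP[/eqP->|/Wx/up//].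
apply: connect_trans (up _ _ (Wx p pW)) (connect1 _).
by rewrite /induced_rel /= epq setU11 in_setU1 pW orbT.
Qed.

End Attaching.

(** * Trees and unicyclic graphs *)
Section Cycles.
Variables (V : finType) (e : rel V).

Lemma next_next_neq (c : seq V) x :
  uniq c -> (2 < size c)%N -> x \in c -> next c (next c x) != x.
Proof.
move=> uc sz xc; have [i s Ec] := rot_to xc.
have ui : uniq (x :: s) by rewrite -Ec rot_uniq.
rewrite -!(next_rot i uc) Ec.
have : (2 < size (x :: s))%N by rewrite -Ec size_rot.
case: s ui {Ec} => [//|y [//|z s]] /= ui _; rewrite eqxx.
move: ui; rewrite !inE !negb_or => /andP[/and3P[xy xz _] _].
by rewrite [y == x]eq_sym (negbTE xy) eqxx eq_sym.
Qed.

(** If the edges leaving [x] and [y] coincide although [x != y], then the cycle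
    returns to [x] after two steps. *)
Lemma card_cycle_edges (c : seq V) : uniq c -> (2 < size c)%N ->
  #|[set [set x; next c x] | x in c]| = size c.
Proof.
move=> uc sz; rewrite card_in_imset ?(card_uniqP uc) // => x y xc yc E.
apply/eqP; have := set21 x (next c x); rewrite E in_set2 => /orP[//|/eqP xy].
have := set21 y (next c y); rewrite -E in_set2 => /orP[/eqP->//|/eqP yx].
by have := next_next_neq uc sz xc; rewrite -yx -xy eqxx.
Qed.

End Cycles.

Section Start.
Variables (K : fieldType) (n : nat) (e : rel 'I_n).
Hypothesis He : simple_graph e.

Lemma regularity_tree : is_tree e -> regularity_le_card K e setT.
Proof.
case=> -[card_gt0 conn] acyclic.
have [v _] := card_gt0P card_gt0.
apply: (regularity_le_order He (W0 := [set v])) => //.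
- by move=> C /acyclic.
- by exists v; rewrite ?set11 // => x /set1P ->; apply: connect0.
exists 0; split; last by rewrite cards1.
apply: regularity_at_most_one_edge => // j j' /subsetP jv.
have [x [y [exy E]]] := edgeP j; have := adj_neq He exy.
have /set1P -> : x \in [set v] by apply: jv; rewrite E set21.
have /set1P -> : y \in [set v] by apply: jv; rewrite E set22.
by rewrite eqxx.
Qed.

Lemma cycle_vertices (c : seq 'I_n) (C : {set {set 'I_n}}) :
  C = [set [set x; next c x] | x in c] ->
  {in C, forall S : {set 'I_n}, S \subset [set x in c]}.
Proof.
by move=> -> S /imsetP[x xc ->]; rewrite subUset !sub1set !inE mem_next xc.
Qed.

Lemma induced_connected_cycle (c : seq 'I_n) :
  (0 < size c)%N -> cycle e c -> induced_connected e [set x in c].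
Proof.
case: c => [//|x s] _ /=; rewrite rcons_path => /andP[sP _].
have xs_sub : all (mem [set z in x :: s]) (x :: s) by apply/allP=> z; rewrite !inE.
exists x; first by rewrite !inE eqxx.
move=> y; rewrite inE; apply: path_connect.
apply: sub_in_path xs_sub sP => y1 y2 y1s y2s e12.
by apply/and3P; split.
Qed.

(** The construction starts from the vertices of the cycle.  A 4-cycle has no
    chord, because a chord would cut off a triangle, which is a second cycle. *)
Lemma regularity_unicyclic d :
  (d = 3 \/ d = 4)%N -> connected_unicyclic e d -> regularity_le_card K e setT.
Proof.
move=> d34 [[_ conn] [C [[c [sz /andP[cyc uc] CE]] uniqC cardC]]].
have e_sym : ssrbool.symmetric e := proj1 He.
have szd : size c = d by rewrite -cardC CE card_cycle_edges.
apply: (regularity_le_order He (W0 := [set x in c])) => //.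
- by move=> C' /uniqC ->; apply: cycle_vertices CE.
- by apply: induced_connected_cycle cyc; apply: leq_trans sz.
have cardW0 : #|[set x in c]| = d by rewrite cardsE (card_uniqP uc).
rewrite /regularity_le_card cardW0.
case: d34 => Ed; rewrite {}Ed in szd *.
  case: c szd sz cyc uc {CE cardW0} => [|x [|y [|z [|? ?]]]] //= _ _ cyc uc.
  have -> : [set v in [:: x; y; z]] = [set x; y; z] by apply/setP=> v; rewrite !inE orbA.
  case/and4P: cyc => exy eyz ezx _.
  by exists 1; split=> //; apply: regularity_triangle; rewrite // e_sym.
case: c szd sz cyc uc CE {cardW0} => [|x [|y [|z [|t [|? ?]]]]] //= _ _ cyc uc CE.
have -> : [set v in [:: x; y; z; t]] = [set x; y; z; t].
  by apply/setP=> v; rewrite !inE !orbA.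
case/and5P: cyc => exy eyz ezt etx _.
have U := uc; distinct_facts U.
have diag a b c' : uniq [:: a; b; c'] -> e a b -> e b c' -> [set c'; a] \notin C -> ~~ e a c'.
  move=> U3 eab ebc nC; apply/negP=> eac; move/negP: nC; apply.
  have /uniqC <- : graph_cycle e [set [set v; next [:: a; b; c'] v] | v in [:: a; b; c']].
    by exists [:: a; b; c']; split=> //; rewrite /ucycle U3 /= eab ebc e_sym eac.
  have Ec : next [:: a; b; c'] c' = a.
    by distinct_facts U3; rewrite /= !eqxx; by_distinct.
  by apply/imsetP; exists c'; rewrite ?Ec // !inE eqxx !orbT.
have notC u v : u != v -> v != next [:: x; y; z; t] u -> u != next [:: x; y; z; t] v ->
    [set u; v] \notin C.
  move=> uv nu nv; apply/negP; rewrite CE => /imsetP[w _ E].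
  have /set2P[wu|wv] : w \in [set u; v] by rewrite E set21.
    have := set22 u v; rewrite E wu in_set2 eq_sym (negbTE uv) /= => /eqP vE.
    by rewrite vE eqxx in nu.
  have := set21 u v; rewrite E wv in_set2 (negbTE uv) /= => /eqP uE.
  by rewrite uE eqxx in nv.
have [nx ny nz nt] : [/\ next [:: x; y; z; t] x = y, next [:: x; y; z; t] y = z,
    next [:: x; y; z; t] z = t & next [:: x; y; z; t] t = x].
  by rewrite /= !eqxx; by_distinct.
exists 2; split=> //; apply: regularity_four_cycle => //.
- apply: (diag x y z) => //; first by rewrite /= !inE; by_distinct.
  by apply: notC; rewrite ?nx ?ny ?nz ?nt; by_distinct.
- apply: (diag y z t) => //; first by rewrite /= !inE; by_distinct.
  by apply: notC; rewrite ?nx ?ny ?nz ?nt; by_distinct.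
Qed.

End Start.

Theorem corollary2p4 (K : fieldType) (n : nat) (e : rel 'I_n)
    (He : simple_graph e)
    (HG : is_tree e \/
          exists d : nat, (d = 3 \/ d = 4)%N /\ connected_unicyclic e d) :
  exists r : int, is_regularity (@rees_ideal K n e) r /\ r <= n%:Z.
Proof.
have [r [rT le_r]] : regularity_le_card K e setT.
  case: HG => [|[d [d34 uni]]]; first exact: regularity_tree.
  exact: regularity_unicyclic d34 uni.
rewrite cardsT card_ord in le_r; exists r; split=> //.
by apply: is_regularity_ext rT => p; rewrite rees_ideal_subgraph.
Qed.
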